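(* Let $\mathrm{k}$ be a field, let $G$ be a finite simple graph on $[n]=\{1,\dots,n\}$ with edge set $E(G)$, and let $\mathbf{w}:E(G)\to\mathbb{Z}_{>0}$ be a weight function. Then the ideal $I(G,\mathbf{w})\subseteq S=\mathrm{k}[x_1,\dots,x_n]$ is normal if and only if $(G,\mathbf{w})$ has none of the configurations $F_1,F_2,F_3,F_4,F_5$ as an induced edge-weighted subgraph.
   Context: The edge ideal of $(G,\mathbf{w})$ is $I(G,\mathbf{w})=\big((x_ix_j)^{\mathbf{w}(e)} \mid e=\{i,j\}\in E(G)\big)\subseteq S=\mathrm{k}[x_1,\dots,x_n]$. An ideal $I$ is normal if $I^t=\overline{I^t}$ for all integers $t\ge 1$, where $\overline{J}$ denotes the integral closure of $J$. The zero ideal (the case $E(G)=\emptyset$) is regarded as normal. An induced edge-weighted subgraph of $(G,\mathbf{w})$ is an induced subgraph $G[U]$, $U\subseteq[n]$, with the restriction of $\mathbf{w}$ to its edges. An edge $e$ is nontrivial if $\mathbf{w}(e)>1$ and trivial if $\mathbf{w}(e)=1$. The configurations (each a family of edge-weighted graphs, up to isomorphism) are: $F_1$: a path on three vertices with two edges, both nontrivial (the two end vertices are not adjacent). $F_2$: a triangle all of whose three edges are nontrivial. $F_3$: the disjoint union of two nontrivial edges (four vertices, exactly two edges, which are disjoint). $F_4$: the disjoint union of an odd cycle (of any odd length $\ge 3$, with arbitrary positive integer weights on its edges) and one nontrivial edge; there are no other edges. $F_5$: two vertex-disjoint odd cycles (each of any odd length $\ge 3$, without chords, with arbitrary positive integer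 weights on their edges) together with a possibly empty set of edges each joining a vertex of one cycle to a vertex of the other, all of these joining edges being nontrivial; there are no other edges. *)

(* Defs.v *)
From HB Require Import structures.
From mathcomp Require Import all_boot all_order all_algebra.
From mathcomp Require Import mpoly.

Set Implicit Arguments.
Unset Strict Implicit.
Unset Printing Implicit Defensive.

Import GRing.Theory.
Local Open Scope ring_scope.

(* Ideals are Prop-valued predicates: membership in a generated ideal is not
   boolean. *)
Section Ideals.
Variable R : comNzRingType.
Implicit Types (A I J : R -> Prop) (x : R).

Definition ideal_gen A x : Prop :=
  exists s : seq (R * R),
    (forall p, p \in s -> A p.2) /\ x = \sum_(p <- s) p.1 * p.2.

Definition ideal_mul I J : R -> Prop :=
  ideal_gen (fun x => exists a b, [/\ I a, J b & x = a * b]).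

Definition ideal_exp I (t : nat) : R -> Prop :=
  iter t (ideal_mul I) (fun=> True).

Definition int_closure J x : Prop :=
  exists (m : nat) (a : nat -> R),
    [/\ (0 < m)%N,
        forall i, (1 <= i <= m)%N -> ideal_exp J i (a i)
      & x ^+ m + \sum_(1 <= i < m.+1) a i * x ^+ (m - i) = 0].

Definition normal_ideal I : Prop :=
  forall t, (1 <= t)%N ->
  forall x, ideal_exp I t x <-> int_closure (ideal_exp I t) x.

End Ideals.

(* The values of wt on non-adjacent pairs are irrelevant. *)
Record wgraph (T : finType) := WGraph {
  adj : rel T;
  wt : T -> T -> nat;
  adj_sym : forall x y, adj x y = adj y x;
  adj_irr : irreflexive adj;
  wt_sym : forall x y, adj x y -> wt x y = wt y x;
  wt_gt0 : forall x y, adj x y -> (0 < wt x y)%N }.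

Section Induced.
Variables (T : finType) (G : wgraph T) (U : {set T}).
Let V := {x : T | x \in U}.

Definition induced : wgraph V :=
  @WGraph V (fun x y => adj G (val x) (val y))
            (fun x y => wt G (val x) (val y))
            (fun x y => adj_sym G (val x) (val y))
            (fun x => adj_irr G (val x))
            (fun x y => @wt_sym T G (val x) (val y))
            (fun x y => @wt_gt0 T G (val x) (val y)).

End Induced.

Section Configurations.
Variables (T : finType) (H : wgraph T).

Definition nontrivial_edge (x y : T) : bool := adj H x y && (1 < wt H x y)%N.

Definition spans (s : seq T) : Prop := uniq s /\ forall x, x \in s.

(* The vertices of c, in cyclic order, induce a chordless odd cycle. *)
Definition odd_cycle (c : seq T) : Prop :=
  [/\ uniq c, (3 <= size c)%N, odd (size c)
    & {in c &, forall x y, adj H x y = (y == next c x) || (x == next c y)}].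

Definition isF1 : Prop :=
  exists a b c, [/\ spans [:: a; b; c],
    nontrivial_edge a b, nontrivial_edge b c & ~~ adj H a c].

Definition isF2 : Prop :=
  exists a b c, [/\ spans [:: a; b; c],
    nontrivial_edge a b, nontrivial_edge b c & nontrivial_edge a c].

Definition isF3 : Prop :=
  exists a b c d, [/\ spans [:: a; b; c; d],
    nontrivial_edge a b, nontrivial_edge c d
    & {in [:: a; b] & [:: c; d], forall x y, ~~ adj H x y}].

Definition isF4 : Prop :=
  exists c a b, [/\ spans (c ++ [:: a; b]),
    odd_cycle c, nontrivial_edge a b
    & {in c & [:: a; b], forall x y, ~~ adj H x y}].

Definition isF5 : Prop :=
  exists c d, [/\ spans (c ++ d), odd_cycle c, odd_cycle d
    & {in c & d, forall x y, adj H x y -> nontrivial_edge x y}].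

End Configurations.

Definition has_induced (T : finType) (G : wgraph T)
    (F : forall V : finType, wgraph V -> Prop) : Prop :=
  exists U : {set T}, F _ (induced G U).

Definition edge_ideal (k : fieldType) (n : nat) (G : wgraph 'I_n) :
    {mpoly k[n]} -> Prop :=
  ideal_gen (fun f => exists i j, adj G i j /\ f = ('X_i * 'X_j) ^+ wt G i j).

(* Main.v *)
Require Import Defs.
From HB Require Import structures.
From mathcomp Require Import all_boot all_order all_algebra zify ring.
From mathcomp Require Import mpoly.
From Stdlib Require Import Classical_Prop.

Set Implicit Arguments.
Unset Strict Implicit.
Unset Printing Implicit Defensive.

(* A monomial x^u lies in I^t iff some multiset of t edges has load at most u,
   and it is integral over I^t iff, for some m > 0, some multiset of tm edges
   has load at most mu.  So normality says that fractional edge packings round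
   to integral ones of the same integer size.

   If a configuration is present, a fractional packing with all coefficients one
   half fails to round: on two adjacent or disjoint nontrivial edges for F1, F2
   and F3, on the cycles (and the nontrivial edge) for F4 and F5, where a
   nontrivial edge on a cycle would produce an earlier configuration.

   Without configurations, two distinct nontrivial edges are always joined by a
   trivial edge xy, and since their weights are at least 2 they can be replaced
   by two copies of xy without increasing the load; hence only one nontrivial
   edge ab is needed, and its integral part can be split off.  For the trivial
   edges, Koenig's theorem in the bipartite double cover gives an optimal
   packing made of edges and of half odd cycles.  By the absence of F5 any two
   odd cycles meet or are joined by a trivial edge, so pairs of half odd cycles
   can be traded for edges and at most one of them remains.  If the fractional
   part of ab still matters, it is at least one half, so it leaves one unit of
   room at a and at b, and by the absence of F4 the last half odd cycle absorbs
   this room through a trivial edge to a or b. *)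

(** * Odd closed walks and chordless odd cycles *)

Section OddWalks.
Variables (T : eqType) (e : rel T).

Definition odd_walk (c : seq T) : bool := cycle e c && odd (size c).

Lemma odd_walk_rot i c : odd_walk (rot i c) = odd_walk c.
Proof. by rewrite /odd_walk rot_cycle size_rot. Qed.

Hypothesis e_sym : ssrbool.symmetric e.

Lemma cycle_chord x y p q :
  e x y -> cycle e (x :: p ++ y :: q) ->
  cycle e (x :: rcons p y) /\ cycle e (y :: rcons q x).
Proof.
move=> exy /=; rewrite rcons_cat cat_path /= rcons_path => /and4P[xp py yq qx].
by rewrite !rcons_path /= !last_rcons xp py (e_sym y x) exy yq qx.
Qed.

Lemma cycle_double x p q :
  cycle e (x :: p ++ x :: q) -> cycle e (x :: p) /\ cycle e (x :: q).
Proof.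
rewrite /= rcons_cat cat_path /= !rcons_path.
by case/and4P=> -> -> -> ->.
Qed.

Lemma nuniq_rot (c : seq T) :
  ~~ uniq c -> exists i x p q, rot i c = x :: p ++ x :: q.
Proof.
move=> Uc; have [x xc] : exists x, 1 < count_mem x c.
  elim: c Uc => //= x c IHc; rewrite negb_and negbK; case/orP=> [xc|/IHc[y yc]].
    by exists x; rewrite eqxx add1n ltnS -has_count has_pred1.
  by exists y; lia.
have [|i p def_c] := @rot_to _ c x; first by rewrite -has_pred1 has_count ltnW.
have: x \in p.
  have /permP eq_c: perm_eq c (x :: p) by rewrite -def_c perm_sym perm_rot.
  by move: xc; rewrite eq_c /= eqxx add1n ltnS -has_count has_pred1.
by move=> xp; case/splitPr: xp def_c => p1 p2 def_c; exists i, x, p1, p2.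
Qed.

Hypothesis e_irr : irreflexive e.

(** A repeated vertex or a chord cuts an odd closed walk into two shorter closed walks, one of which
    is odd by parity; induction on the length ends at a chordless cycle. *)
Lemma odd_walk_chordless c : odd_walk c ->
  exists c', [/\ {subset c' <= c}, uniq c', 3 <= size c', odd (size c') &
    {in c' &, forall x y, e x y = (y == next c' x) || (x == next c' y)}].
Proof.
have [n] := ubnP (size c); elim: n c => // n IHn c /ltnSE le_cn.
have IH i c1 : {subset c1 <= rot i c} -> size c1 < size (rot i c) ->
    odd_walk c1 -> exists c', [/\ {subset c' <= c}, uniq c', 3 <= size c',
      odd (size c') &
      {in c' &, forall x y, e x y = (y == next c' x) || (x == next c' y)}].
  rewrite size_rot => sc1 lt1 wc1.
  have [|c' [sc' Uc' lec' oddc' ec']] := IHn _ _ wc1.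
    exact: leq_trans lt1 _.
  by exists c'; split=> // x /sc'/sc1; rewrite mem_rot.
case Uc: (uniq c); last first.
  have [i [x [p [q def_c]]]] := nuniq_rot (negbT Uc).
  rewrite -(odd_walk_rot i) def_c => /andP[/cycle_double[cp cq]].
  have sub1 : {subset x :: p <= rot i c}.
    by move=> y; rewrite def_c !inE mem_cat => /orP[]->; rewrite ?orbT.
  have sub2 : {subset x :: q <= rot i c}.
    by move=> y; rewrite def_c -cat_cons mem_cat orbC => ->.
  have [oddp _|evp] := boolP (odd (size (x :: p))).
    by apply: IH sub1 _ _; rewrite /odd_walk ?cp // def_c /= size_cat /=; lia.
  move=> oddc; apply: IH sub2 _ _; rewrite /odd_walk ?cq ?def_c /= ?size_cat /=.
    by lia.
  by move: evp oddc; rewrite /= size_cat /= oddD /=; lia.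
move=> wc; case/andP: (wc) => cc oddc.
have e_next x : x \in c -> e x (next c x) by exact: next_cycle.
(* A closed walk of length one would be a loop; lengths zero and two are even. *)
have c3 : 2 < size c.
  case: (c) cc oddc => [|x [|y [|z c1]]] //=.
  by rewrite e_irr.
pose ok x y := e x y == (y == next c x) || (x == next c y).
have [/allrelP chl|] := boolP (allrel ok c c).
  by exists c; split=> // x y xc yc; apply/eqP/chl.
case/allPn=> x xc /allPn[y yc]; rewrite /ok.
have [->|nyx] := eqVneq y (next c x); first by rewrite e_next.
have [->|nxy] := eqVneq x (next c y); first by rewrite e_sym e_next ?orbT.
rewrite /= eqbF_neg negbK => exy.
have neq_xy : x != y by apply: contraTneq exy => ->; rewrite e_irr.
have [i p q _ _ def_c] := rot_to_arc Uc xc yc neq_xy.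
rewrite -(odd_walk_rot i) def_c in wc.
case/andP: wc => /(cycle_chord exy)[cp cq] odd_pq.
have Upq : uniq (x :: p ++ y :: q) by rewrite -def_c rot_uniq.
(* Both arcs have inner vertices because [x] and [y] are not consecutive on [c], so each half is
   shorter than [c]. *)
have p_gt0 : 0 < size p.
  rewrite lt0n size_eq0; apply: contraNneq nyx => p0.
  by rewrite -(next_rot i Uc) def_c p0 /= eqxx.
have q_gt0 : 0 < size q.
  rewrite lt0n size_eq0; apply: contraNneq nxy => q0.
  rewrite -(next_rot i Uc) def_c -(next_rot (size (x :: p)) Upq).
  by rewrite -cat_cons rot_size_cat q0 /= eqxx.
have sub1 : {subset x :: rcons p y <= rot i c}.
  move=> z; rewrite def_c !inE mem_rcons mem_cat !inE.
  by case/or3P=> ->; rewrite ?orbT.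
have sub2 : {subset y :: rcons q x <= rot i c}.
  move=> z; rewrite def_c !inE mem_rcons mem_cat !inE.
  by case/or3P=> ->; rewrite ?orbT.
have [oddp|evp] := boolP (odd (size (x :: rcons p y))).
  apply: IH sub1 _ _; last by rewrite /odd_walk cp.
  by rewrite def_c /= size_cat size_rcons /=; clear -q_gt0; lia.
apply: IH sub2 _ _.
  by rewrite def_c /= size_cat size_rcons /=; clear -p_gt0; lia.
rewrite /odd_walk cq; move: odd_pq evp.
rewrite /= size_cat !size_rcons /= oddD /=.
by case: (odd (size p)); case: (odd (size q)).
Qed.

End OddWalks.

(** * Matchings combined with odd closed walks *)

Section Matchings.
Variables (W : eqType) (e : rel W).
Implicit Types (M : seq (W * W)) (L : seq (seq W)).

Definition ends M : seq W := flatten [seq [:: q.1; q.2] | q <- M].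

Lemma ends_cat M1 M2 : ends (M1 ++ M2) = ends M1 ++ ends M2.
Proof. by rewrite /ends map_cat flatten_cat. Qed.

Lemma size_ends M : size (ends M) = 2 * size M.
Proof. by elim: M => //= q M IHM; rewrite IHM mulnS. Qed.

(* A matching together with pairwise disjoint odd closed walks: the vertices it
   covers number twice the value of the half-integral packing that gives weight
   one to the matching edges and one half to the edges of the walks. *)
Definition half_matching M L : bool :=
  [&& all (fun q => e q.1 q.2) M, all (odd_walk e) L
    & uniq (ends M ++ flatten L)].

Definition covered M L : seq W := ends M ++ flatten L.

(** Greedy choice from the left: an edge that is taken blocks only the next pair, so at least half
    of the consecutive pairs joined by [e] are kept. *)
Lemma path_matching x p :
  exists M, [/\ all (fun q => e q.1 q.2) M, subseq (ends M) (x :: p)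
    & count id (pairmap e x p) <= 2 * size M].
Proof.
have [n] := ubnP (size p); elim: n x p => // n IHn x [|y p] lt_pn.
  by exists [::]; split.
have [exy|nexy] := boolP (e x y); last first.
  have [|M [eM sM cM]] := IHn y p; first by move: lt_pn => /=; lia.
  exists M; split=> //=; last by rewrite (negbTE nexy).
  exact: subseq_trans sM (subseq_cons _ _).
case: p lt_pn => [|z p] lt_pn.
  by exists [:: (x, y)]; split; rewrite /= ?exy // !eqxx.
have [|M [eM sM cM]] := IHn z p; first by move: lt_pn => /=; lia.
exists ((x, y) :: M); split; rewrite /= ?exy //.
  by rewrite !eqxx.
by case: (e y z); lia.
Qed.

Lemma count_pairmap_path x p :
  path e x p -> count id (pairmap e x p) = size p.
Proof. by elim: p x => //= y p IHp x /andP[-> /IHp->]. Qed.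

(** Without [x] the walk is a path on an even number of vertices, and its alternate edges match it
    perfectly. *)
Lemma odd_walk_matching C x : odd_walk e C -> x \in C ->
  exists M, all (fun q => e q.1 q.2) M /\ perm_eq (x :: ends M) C.
Proof.
move=> wC xC; have [i p def_C] := rot_to xC.
move: wC; rewrite -(odd_walk_rot e i) def_C /odd_walk /= => /andP[cC odd_p].
case: p def_C cC odd_p => [|y p] def_C cC odd_p.
  by exists [::]; split=> //; rewrite perm_sym -def_C perm_sym perm_rot.
have [M [eM sM cM]] := path_matching y p.
exists M; split=> //.
have pp : path e y p by move: cC; rewrite /= rcons_path => /and3P[].
(* The ends are even in number and at least [size p], which is odd, so the subsequence is the whole
   path. *)
have -> : ends M = y :: p.
  apply/eqP; rewrite -(size_subseq_leqif sM) size_ends /= eqn_leq.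
  have := size_subseq sM; rewrite size_ends /= => ->.
  by move: cM odd_p; rewrite count_pairmap_path //=; lia.
by rewrite -def_C perm_rot.
Qed.

(** Given an edge [x y] between two odd walks, match each walk without its end of the edge and add
    [x y]: the same vertices are covered with two walks fewer. *)
Lemma half_matching_merge M L :
  (forall C D, odd_walk e C -> odd_walk e D ->
     exists x y, [/\ x \in C, y \in D & e x y]) ->
  half_matching M L -> exists M' L',
  [/\ half_matching M' L', size L' <= 1
    & perm_eq (covered M' L') (covered M L)].
Proof.
move=> occ; have [n] := ubnP (size L).
elim: n M L => // n IHn M [|C [|D L]] lt_Ln hML.
- by exists M, [::]; split.
- by exists M, [:: C]; split.
case/and3P: (hML) => /= eM /and3P[wC wD wL] Uc.
have [x [y [xC yD exy]]] := occ C D wC wD.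
have [M1 [eM1 pM1]] := odd_walk_matching wC xC.
have [M2 [eM2 pM2]] := odd_walk_matching wD yD.
pose M' := (x, y) :: M1 ++ M2 ++ M.
have pM' : perm_eq (covered M' L) (covered M [:: C, D & L]).
  rewrite /covered.
  have -> : ends M' = [:: x, y & ends M1 ++ ends M2 ++ ends M].
    by rewrite -!ends_cat.
  rewrite /=.
  apply/permP=> a; move/permP/(_ a): pM1; move/permP/(_ a): pM2.
  by rewrite /= !count_cat /= => <- <-; clear; lia.
have [||M3 [L3 [h3 s3 p3]]] := IHn M' L; first exact: ltnW lt_Ln.
  rewrite /half_matching wL -/(covered M' L) (perm_uniq pM') /covered Uc.
  by rewrite /M' /= !all_cat exy eM1 eM2 eM.
by exists M3, L3; split=> //; apply: perm_trans p3 pM'.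
Qed.

End Matchings.

(** * Koenig duality in the bipartite double cover *)

Section Konig.
Variables (W : finType) (e : rel W).
Implicit Types (f : W -> W).

(** An injection is a matching of the double cover completed to a permutation; [good] marks the arcs
    that belong to [e]. Augmenting then amounts to composing with a cyclic permutation. *)
Definition good f : {set W} := [set x | e x (f x)].

(** If all arcs of the orbit are good, it is an odd walk or an even cycle with a perfect matching.
    Otherwise cutting it at a bad arc leaves a vertex sequence for the greedy matching. *)
Lemma orbit_half_matching f x : injective f ->
  exists M L, [/\ half_matching e M L, {subset covered M L <= orbit f x}
    & #|good f :&: [set y in orbit f x]| <= size (covered M L)].
Proof.
move=> injf.
pose g w := e w (f w).
have cardE c : uniq c -> #|good f :&: [set y in c]| = count g c.
  move=> Uc; rewrite -size_filter -(card_uniqP (filter_uniq _ Uc)).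
  by apply: eq_card => y; rewrite !inE mem_filter.
have [/allP good_x|/allPn[y y_x bad_y]] := boolP (all g (orbit f x)).
  have Ux := orbit_uniq f x.
  have cycx : cycle e (orbit f x).
    apply: (cycle_from_next Ux) => y yx.
    by rewrite (nextE (cycle_orbit injf x) yx); apply: good_x.
  have [odd_x|ev_x] := boolP (odd (size (orbit f x))).
    exists [::], [:: orbit f x].
    rewrite /half_matching /covered /= /odd_walk cycx odd_x cats0; split=> //.
    by rewrite cardE ?count_size.
  rewrite cardE //; move: Ux cycx ev_x.
  case: (orbit f x) => [|y p] Uyp; first by exists [::], [::]; split.
  rewrite /= rcons_path => /andP[pp _]; rewrite negbK => odd_p.
  have [M [eM sM cM]] := path_matching e y p.
  exists M, [::]; rewrite /half_matching /covered /= cats0 size_ends.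
  split; first by rewrite eM (subseq_uniq sM).
    exact: mem_subseq.
  rewrite count_pairmap_path // in cM.
  apply: leq_trans (count_size g (y :: p)) _.
  rewrite /= ltn_neqAle cM andbT; apply: contraTneq odd_p => ->.
  by rewrite mul2n odd_double.
(* The orbit is restarted just after the bad arc, which thus becomes the closing one. *)
have eq_orb : orbit f (f y) =i orbit f x.
  move=> w; rewrite -!fconnect_orbit -(same_fconnect1 injf).
  apply/idP/idP; apply: connect_trans; first by rewrite fconnect_orbit.
  by rewrite fconnect_sym // fconnect_orbit.
have -> : [set w in orbit f x] = [set w in orbit f (f y)].
  by apply/setP=> w; rewrite !inE eq_orb.
rewrite cardE ?orbit_uniq //.
have := cycle_orbit injf (f y); have := orbit_uniq f (f y).
have [p def_p] : exists p, orbit f (f y) = f y :: p.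
  by rewrite /orbit -orderSpred /=; eexists.
rewrite def_p => Up /=; rewrite rcons_path => /andP[pp /eqP/injf last_p].
have [M [eM sM cM]] := path_matching e (f y) p.
exists M, [::]; rewrite /half_matching /covered /= cats0 size_ends.
split; first by rewrite eM (subseq_uniq sM).
  by move=> w /(mem_subseq sM); rewrite -def_p eq_orb.
apply: leq_trans cM; rewrite -[_ + _]/(count g (f y :: p)) lastI last_p.
rewrite -cats1 count_cat /= (negbTE bad_y) !addn0.
elim: p (f y) pp {def_p Up last_p M eM sM} => //= z p IHp w /andP[/eqP<- /IHp].
by rewrite /g => le_p; rewrite leq_add2l.
Qed.

(** The orbits of [f] partition the vertices; they are removed one at a time from an [f]-stable
    set. *)
Lemma injective_half_matching f : injective f ->
  exists M L, half_matching e M L /\ #|good f| <= size (covered M L).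
Proof.
move=> injf.
suff [M [L [hML _ cML]]] : exists M L, [/\ half_matching e M L,
    {subset covered M L <= [set: W]} &
    #|good f :&: [set: W]| <= size (covered M L)].
  by exists M, L; rewrite setIT in cML.
have : {in [set: W], forall x, f x \in [set: W]} by move=> x; rewrite !inE.
have [n] := ubnP #|[set: W]|; elim: n [set: W] => // n IHn A lt_An fA.
have [->|[x xA]] := set_0Vmem A.
  by exists [::], [::]; split=> //; rewrite setI0 cards0.
have sub_orb : {subset orbit f x <= A}.
  move=> y; rewrite -fconnect_orbit => /iter_findex <-.
  by elim: (findex _ _ _) => //= k; apply: fA.
pose B := A :\: [set y in orbit f x].
have [||M1 [L1 [h1 s1 c1]]] := IHn B.
- rewrite -ltnS; apply: leq_trans lt_An; rewrite ltnS.
  apply: proper_card; apply/properP; split; first exact: subsetDl.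
  by exists x; rewrite // !inE -fconnect_orbit connect0.
- move=> y; rewrite !inE => /andP[nxy /fA ->]; rewrite andbT.
  by rewrite -fconnect_orbit -(same_fconnect1_r injf) fconnect_orbit.
have [M2 [L2 [h2 s2 c2]]] := orbit_half_matching x injf.
exists (M1 ++ M2), (L1 ++ L2).
have pC : perm_eq (covered (M1 ++ M2) (L1 ++ L2))
                  (covered M1 L1 ++ covered M2 L2).
  rewrite /covered ends_cat flatten_cat; apply/permP=> a.
  by rewrite !count_cat; lia.
split.
- case/and3P: h1 => e1 w1 U1; case/and3P: h2 => e2 w2 U2.
  rewrite /half_matching !all_cat e1 e2 w1 w2 -/(covered _ _) (perm_uniq pC).
  rewrite cat_uniq U1 U2 /= andbT -all_predC; apply/allP=> y /s2 y_x /=.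
  by apply: contraL y_x => /s1; rewrite !inE => /andP[].
- move=> y; rewrite (perm_mem pC) mem_cat => /orP[/s1|/s2/sub_orb //].
  by rewrite inE => /andP[].
- rewrite (perm_size pC) size_cat addnC.
  apply: leq_trans (leq_add c2 c1).
  have -> : good f :&: A = (good f :&: [set y in orbit f x]) :|: (good f :&: B).
    apply/setP=> y; rewrite !inE -andb_orr; congr (_ && _).
    by have [/sub_orb->|] := boolP (y \in orbit f x).
  exact: leq_card_setU.
Qed.

(* Koenig's theorem in the bipartite double cover of [e]: an injection with as
   many arcs of [e] as possible is dual to a vertex cover. *)
Lemma konig : exists f (C D : {set W}), [/\ injective f,
  forall x y, e x y -> (x \in C) || (y \in D) & #|C| + #|D| <= #|good f|].
Proof.
suff [f [injf [C [D [cov le]]]]] : exists f, injective f /\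
    exists C D : {set W}, (forall x y, e x y -> (x \in C) || (y \in D)) /\
      #|C| + #|D| <= #|good f|.
  by exists f, C, D.
have: injective (@id W) by [].
have [n] := ubnP #|~: good (@id W)|; elim: n (@id W) => // n IHn f lt_n injf.
(* A step of [h] lets [x] take over the image of [y]; [R1] collects what such alternating walks
   reach from vertices that are not good. *)
pose h x y := e x (f y).
pose reach x y := [exists z, h x z && connect h z y].
pose R1 := [set y | [exists x, (x \notin good f) && reach x y]].
have [/existsP[y /andP[yR1 bad_y]]|noaug] :=
    boolP [exists y, (y \in R1) && (y \notin good f)].
  move: yR1; rewrite inE => /existsP[x /andP[bad_x /existsP[z /andP[hxz zy]]]].
  (* Shifting images along [s] makes [x] good and loses no good vertex: [s] is either a closed
     [h]-walk through [x] or a walk from [x] to [y], where only the bad [y] gets an arbitrary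
     image. *)
  have [s [Us gs xs hx]] : exists s, [/\ uniq s,
      {in s, forall w, w \in good f -> h w (next s w)}, x \in s
      & h x (next s x)].
    case/connectP: zy => p0 /shortenP[p zp Uzp _] def_y {p0}.
    have [xp|xNzp] := boolP (x \in z :: p).
      case/splitPl: p / xp zp Uzp {def_y} => p1 p2 def_x.
      rewrite cat_path => /andP[zp1 _].
      rewrite -cat_cons cat_uniq => /and3P[Us _ _].
      have cs : cycle h (z :: p1) by rewrite /= rcons_path zp1 def_x.
      exists (z :: p1); split=> //.
      - by move=> w /(next_cycle cs).
      - by rewrite -def_x mem_last.
      by rewrite (next_cycle cs) // -def_x mem_last.
    exists [:: x, z & p]; rewrite /= eqxx mem_head xNzp; split=> //.
    pose h' u v := h u v || (u == y).
    have cs : cycle h' [:: x, z & p].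
      rewrite /= {1}/h' hxz /= rcons_path /h' -def_y eqxx orbT andbT.
      by apply: sub_path zp => u v; rewrite /h' => ->.
    move=> w ws gw; case/orP: (next_cycle cs ws) => // /eqP eq_wy.
    by rewrite eq_wy (negbTE bad_y) in gw.
  apply: (IHn (f \o next s)); last first.
    by apply: inj_comp injf (can_inj (prev_next Us)).
  rewrite -ltnS; apply: leq_trans lt_n; rewrite ltnS; apply: proper_card.
  have sg w : w \in good f -> w \in good (f \o next s).
    move=> gw; rewrite inE /=; have [ws|wNs] := boolP (w \in s).
      exact: gs ws gw.
    by rewrite next_nth (negbTE wNs); rewrite inE in gw.
  apply/properP; split.
    by apply/subsetP=> w; rewrite !in_setC; apply: contra => /sg.
  by exists x; rewrite in_setC // negbK inE.
exists f; split=> //.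
(* An arc of [e] leaving [R] ends in the image of [R1]. As [R1] now contains good vertices only, the
   two parts of the cover together are as numerous as [good f]. *)
pose R := R1 :|: ~: good f.
exists (~: R), (f @: R1); split=> [x y exy|].
  rewrite in_setC; have [xR /=|//] := boolP (x \in R); apply/imsetP.
  exists (invF injf y); last by rewrite f_invF.
  move: xR; rewrite !inE.
  case/orP=> [/existsP[w /andP[bw /existsP[z /andP[hwz zx]]]]|bx].
    apply/existsP; exists w; rewrite bw; apply/existsP; exists z; rewrite hwz.
    by apply: connect_trans zx (connect1 _); rewrite /h f_invF.
  apply/existsP; exists x; rewrite inE bx.
  by apply/existsP; exists (invF injf y); rewrite /h f_invF exy connect0.
have cR : #|R| = #|R1| + #|~: good f|.
  rewrite cardsU; suff -> : R1 :&: ~: good f = set0 by rewrite cards0 subn0.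
  apply/setP=> y; rewrite !in_setI in_setC in_set0; apply: contraNF noaug => ?.
  by apply/existsP; exists y.
by rewrite card_imset //; have := cardsC (good f); have := cardsC R; lia.
Qed.

End Konig.

(** * Edge packings and their loads *)

Lemma sum_delta (T : finType) (a : T) (c : T -> nat) :
  \sum_v (v == a) * c v = c a.
Proof.
rewrite (bigD1 a) //= eqxx mul1n big1 ?addn0 // => v /negbTE->.
by rewrite mul0n.
Qed.

Section Packings.
Variables (T : finType) (G : wgraph T).
Implicit Types (s Y : seq (T * T)) (u : T -> nat) (C : seq T).

(** The exponent of [v] in the product of the generators listed in [s], edges being allowed in
    either orientation. Thus [packs t u] says that the monomial with exponent [u] lies in the [t]-th
    power of the edge ideal. *)
Definition load s (v : T) : nat :=
  \sum_(q <- s) wt G q.1 q.2 * ((v == q.1) + (v == q.2)).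

Definition packing t u s : bool :=
  [&& size s == t, all (fun q => adj G q.1 q.2) s
    & [forall v, load s v <= u v]].

Definition packs t u : Prop := exists s, packing t u s.

Definition trivial_edge x y : bool := adj G x y && (wt G x y == 1).

Lemma packingP t u s :
  reflect [/\ size s = t, all (fun q => adj G q.1 q.2) s
    & forall v, load s v <= u v] (packing t u s).
Proof.
apply: (iffP and3P) => [[/eqP ? ? /forallP ?]|[/eqP ? ? ?]]; split=> //.
exact/forallP.
Qed.

Lemma load_cons q s v :
  load (q :: s) v = wt G q.1 q.2 * ((v == q.1) + (v == q.2)) + load s v.
Proof. by rewrite /load big_cons. Qed.

Lemma load_nil v : load [::] v = 0. Proof. exact: big_nil. Qed.

Lemma load_cat s1 s2 v : load (s1 ++ s2) v = load s1 v + load s2 v.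
Proof. exact: big_cat. Qed.

Lemma load_perm s1 s2 v : perm_eq s1 s2 -> load s1 v = load s2 v.
Proof. exact: perm_big. Qed.

Lemma load_nseq r q v :
  load (nseq r q) v = r * (wt G q.1 q.2 * ((v == q.1) + (v == q.2))).
Proof. by elim: r => [|r IHr]; rewrite /= ?load_nil // load_cons IHr mulSn. Qed.

Lemma packs_ext t u u' : u =1 u' -> packs t u -> packs t u'.
Proof.
move=> eq_u [s /packingP[zs es ls]]; exists s; apply/packingP; split=> // v.
by rewrite -eq_u.
Qed.

Lemma packs_leq t u s : all (fun q => adj G q.1 q.2) s ->
  (forall v, load s v <= u v) -> t <= size s -> packs t u.
Proof.
move=> es ls le_t; exists (take t s); apply/packingP; split.
- exact: size_takel.
- by move: es; rewrite -{1}(cat_take_drop t s) all_cat => /andP[].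
move=> v; apply: leq_trans (ls v).
by rewrite -{2}(cat_take_drop t s) load_cat leq_addr.
Qed.

Lemma trivial_edge_sym : ssrbool.symmetric trivial_edge.
Proof.
move=> x y; rewrite /trivial_edge adj_sym; have [yx|//] := boolP (adj G y x).
by rewrite (wt_sym yx).
Qed.

Lemma nontrivial_edge_sym : ssrbool.symmetric (nontrivial_edge G).
Proof.
move=> x y; rewrite /nontrivial_edge adj_sym; have [yx|//] := boolP (adj G y x).
by rewrite (wt_sym yx).
Qed.

Lemma adj_neq x y : adj G x y -> x != y.
Proof. by apply: contraTneq => ->; rewrite adj_irr. Qed.

Lemma edge_cases x y : adj G x y = trivial_edge x y || nontrivial_edge G x y.
Proof.
rewrite /trivial_edge /nontrivial_edge; have [xy|//] := boolP (adj G x y).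
by have := wt_gt0 xy; rewrite /=; lia.
Qed.

Lemma trivial_all_adj s :
  all (fun q => trivial_edge q.1 q.2) s -> all (fun q => adj G q.1 q.2) s.
Proof. by apply: sub_all => q /andP[]. Qed.

(** Weak duality: half of [c] is a fractional vertex cover of the trivial edges. *)
Lemma dual_bound Y (c : T -> nat) : all (fun q => trivial_edge q.1 q.2) Y ->
    (forall x y, trivial_edge x y -> 2 <= c x + c y) ->
  2 * size Y <= \sum_v load Y v * c v.
Proof.
move=> eY cov; elim: Y eY => [|[x y] Y IHY] /=; first by rewrite muln0.
case/andP=> xy /IHY le_Y; case/andP: (xy) => _ /eqP w1.
under eq_bigr do rewrite load_cons /= w1 mul1n !mulnDl.
by rewrite !big_split /= !sum_delta; have := cov _ _ xy; lia.
Qed.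

(** * Blowing up vertices according to their capacities *)

Section BlowUp.
Variable u : T -> nat.

(** Copies turn capacities into disjointness: since trivial edges have weight one, a matching of
    copies projects to a packing with load at most [u]. *)
Let W : finType := {v : T & 'I_(u v)}.
Let eW (x y : W) := trivial_edge (tag x) (tag y).

Lemma count_tag (l : seq W) v :
  uniq l -> count (fun w => tag w == v) l <= u v.
Proof.
move=> Ul; rewrite -size_filter -[u v]size_enum_ord.
rewrite -(size_map (fun i : 'I_(u v) => (Tagged (fun v => 'I_(u v)) i : W))).
apply: uniq_leq_size; first exact: filter_uniq.
case=> v' i; rewrite mem_filter /= => /andP[/eqP def_v _].
by case: v / def_v; apply/mapP; exists i; rewrite ?mem_enum.
Qed.

Lemma load_tags (M : seq (W * W)) v : all (fun q => eW q.1 q.2) M ->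
  load [seq (tag q.1, tag q.2) | q <- M] v =
  count (fun w => tag w == v) (ends M).
Proof.
elim: M => [|[x y] M IHM] /=; first by rewrite load_nil.
case/andP=> /andP[_ /eqP w1] /IHM IH.
by rewrite load_cons IH /= w1 mul1n !(eq_sym v) addnA.
Qed.

(** A vertex is charged to a side only if all its copies lie there, so the charges cost at most the
    cover, and an edge with both charges missing would have uncovered copies. Reading each edge in
    both directions gives the bound two. *)
Lemma blowup_cover (C D : {set W}) :
    (forall x y, eW x y -> (x \in C) || (y \in D)) ->
  exists c : T -> nat, (forall x y, trivial_edge x y -> 2 <= c x + c y) /\
    \sum_v u v * c v <= #|C| + #|D|.
Proof.
pose tg v (i : 'I_(u v)) : W := Tagged (fun v => 'I_(u v)) i.
pose f (A : {set W}) v := [forall i, tg v i \in A].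
have fle A : \sum_v u v * f A v <= #|A|.
  rewrite -sum1_card (partition_big (fun w : W => tag w) predT) //=.
  apply: leq_sum => v _; rewrite /f.
  case: forallP => [allA|]; last by rewrite muln0.
  have injT : injective (tg v).
    by move=> i j; apply: eq_from_Tagged.
  rewrite muln1 -[X in X <= _]card_ord -(card_imset _ injT) sum1dep_card.
  apply/subset_leq_card/subsetP=> w /imsetP[i _ ->].
  by rewrite inE allA /= eqxx.
move=> cov; exists (fun v => f C v + f D v); split; last first.
  under eq_bigr do rewrite mulnDr.
  by rewrite big_split leq_add.
have fcov x y : trivial_edge x y -> f C x || f D y.
  move=> xy; rewrite -[_ || _]negbK negb_or; apply/negP.
  case/andP=> /forallPn[i xi] /forallPn[j yj].
  by have := cov (tg x i) (tg y j) xy; rewrite (negbTE xi) (negbTE yj).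
move=> x y xy; have := fcov _ _ xy; rewrite trivial_edge_sym in xy.
have := fcov _ _ xy.
by case: (f C x); case: (f D x); case: (f C y); case: (f D y).
Qed.

Hypothesis occ : forall C D, odd_walk trivial_edge C ->
  odd_walk trivial_edge D ->
  exists x y, [/\ x \in C, y \in D & trivial_edge x y].

(* The last alternative is a half-integral cover (scaled by two), which bounds
   every fractional packing by weak duality. *)
Lemma half_integral_packing N :
  [\/ exists Y, [/\ all (fun q => trivial_edge q.1 q.2) Y,
        forall v, load Y v <= u v & N <= 2 * size Y],
      exists C, odd_walk trivial_edge C /\ forall x, x \in C ->
        exists Y, [/\ all (fun q => trivial_edge q.1 q.2) Y,
          forall v, load Y v + (v == x) <= u v & N <= 2 * size Y + 1]
    | exists c : T -> nat, (forall x y, trivial_edge x y -> 2 <= c x + c y) /\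
        \sum_v u v * c v < N].
Proof.
have [f [C0 [D0 [injf cov le_f]]]] := konig eW.
(* With fewer than [N] good arcs the dual cover costs less than [N]; otherwise the arcs yield a
   half-matching covering at least [N] copies. *)
have [ltN|leN] := ltnP #|good eW f| N.
  constructor 3; have [c [cov2 le_c]] := blowup_cover cov.
  by exists c; split=> //; apply: leq_ltn_trans le_c (leq_ltn_trans le_f ltN).
have occW (C D : seq W) : odd_walk eW C -> odd_walk eW D ->
    exists x y, [/\ x \in C, y \in D & eW x y].
  move=> wC wD; have [||x [y [/mapP[x' xC ->] /mapP[y' yD ->] xy]]] :=
    @occ (map (fun w : W => tag w) C) (map (fun w : W => tag w) D).
  - by rewrite /odd_walk cycle_map size_map.
  - by rewrite /odd_walk cycle_map size_map.
  by exists x', y'.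
have [M1 [L1 [h1 s1]]] := injective_half_matching eW injf.
have [M [L [hML sL pML]]] := half_matching_merge occW h1.
have {M1 L1 h1 s1 pML}leN' : N <= size (covered M L).
  by rewrite (perm_size pML); apply: leq_trans leN s1.
case/and3P: hML => eM wL Uc.
pose tags (M : seq (W * W)) := [seq (tag q.1, tag q.2) | q <- M].
have etags M' : all (fun q => eW q.1 q.2) M' ->
  all (fun q => trivial_edge q.1 q.2) (tags M') by rewrite all_map.
case: L sL wL Uc leN' => [|C [|]] //= _.
  rewrite /covered /= cats0 size_ends => _ Uc leN'; constructor 1.
  exists (tags M); rewrite size_map; split=> //; first exact: etags.
  by move=> v; rewrite load_tags // count_tag.
rewrite /covered /= cats0 andbT => wC Uc leN'; constructor 2.
exists (map (fun w : W => tag w) C).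
split; first by case/andP: wC; rewrite /odd_walk cycle_map size_map => -> ->.
move=> _ /mapP[x xC ->].
(* Matching the rest of the last walk leaves the chosen copy [x] free. *)
have [M2 [eM2 pM2]] := odd_walk_matching wC xC.
have pM : perm_eq (x :: ends (M2 ++ M)) (ends M ++ C).
  rewrite ends_cat -cat_cons; apply/permP=> a; move/permP/(_ a): pM2 => /=.
  by rewrite !count_cat /= => <-; lia.
have eM3 : all (fun q => eW q.1 q.2) (M2 ++ M) by rewrite all_cat eM2.
exists (tags (M2 ++ M)); split; first exact: etags.
  move=> v; rewrite load_tags // addnC eq_sym.
  by rewrite -[_ + _]/(count _ (x :: _)) count_tag // (perm_uniq pM).
by move: leN'; rewrite -(perm_size pM) /= size_ends size_map addn1.
Qed.

End BlowUp.

(** * Rounding packings when edges and odd walks are linked *)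

Hypothesis star : forall a b c,
  a != c -> nontrivial_edge G a b -> nontrivial_edge G b c -> trivial_edge a c.
Hypothesis link : forall a b c d,
  nontrivial_edge G a b -> nontrivial_edge G c d -> uniq [:: a; b; c; d] ->
  exists x y, [/\ x \in [:: a; b], y \in [:: c; d] & adj G x y].

(** Edges sharing a vertex are handled by [star]. For disjoint ones, if the edge given by [link] is
    nontrivial, [star] moves its end on [a b] to the other end of [a b]. *)
Lemma trivial_link a b c d :
    nontrivial_edge G a b -> nontrivial_edge G c d ->
    (c, d) != (a, b) -> (c, d) != (b, a) ->
  exists x y, [/\ x \in [:: a; b], y \in [:: c; d] & trivial_edge x y].
Proof.
move=> ab cd; rewrite !xpair_eqE => ne1 ne2.
have ba : nontrivial_edge G b a by rewrite nontrivial_edge_sym.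
have dc : nontrivial_edge G d c by rewrite nontrivial_edge_sym.
have [eq_ac|ac] := eqVneq a c.
  subst c; rewrite eqxx /= in ne1; exists b, d; rewrite !inE !eqxx ?orbT.
  by split=> //; apply: star ba cd; rewrite eq_sym.
have [eq_ad|ad] := eqVneq a d.
  subst d; rewrite eqxx andbT in ne2; exists b, c; rewrite !inE !eqxx ?orbT.
  by split=> //; apply: star ba dc; rewrite eq_sym.
have [eq_bc|bc] := eqVneq b c.
  subst c; exists a, d; rewrite !inE !eqxx ?orbT.
  by split=> //; apply: star ab cd.
have [eq_bd|bd] := eqVneq b d.
  subst d; exists a, c; rewrite !inE !eqxx ?orbT.
  by split=> //; apply: star ab dc.
have [|x [y [xab ycd]]] := link ab cd.
  rewrite /= !inE (negbTE ac) (negbTE ad) (negbTE bc) (negbTE bd) !orbF !andbT.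
  by rewrite !adj_neq //; [case/andP: cd | case/andP: ab].
rewrite edge_cases => /orP[xy|xy]; first by exists x, y.
have nab : (a != y) && (b != y).
  by move: ycd; rewrite !inE => /orP[]/eqP->; rewrite ?ac ?bc ?ad ?bd.
case/andP: nab => nay nby.
move: xab; rewrite !inE => /orP[]/eqP def_x; rewrite {x}def_x in xy.
  by exists b, y; split; rewrite ?(star nby ba xy) // !inE eqxx orbT.
by exists a, y; split; rewrite ?(star nay ab xy) // mem_head.
Qed.

(** Each exchange of two distinct nontrivial edges for two copies of a trivial link lowers the
    number of nontrivial edges by two, so the process stops. *)
Lemma exchange_nontrivial s : all (fun q => adj G q.1 q.2) s ->
  exists s', [/\ size s' = size s, all (fun q => adj G q.1 q.2) s',
    forall v, load s' v <= load s v
    & {in s' &, forall p q, nontrivial_edge G p.1 p.2 ->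
        nontrivial_edge G q.1 q.2 -> q = p \/ q = (p.2, p.1)}].
Proof.
pose nt (q : T * T) := nontrivial_edge G q.1 q.2.
have [n] := ubnP (count nt s); elim: n s => // n IHn s lt_n es.
pose bad p q := [&& nt p, nt q, q != p & q != (p.2, p.1)].
have [/hasP[[a b] ps /hasP[[c d] qs /and4P[ntp ntq ne1 ne2]]]|nbad] :=
    boolP (has (fun p => has (bad p) s) s); last first.
  exists s; split=> // p q ps qs ntp ntq.
  have [->|ne1] := eqVneq q p; first by left.
  have [->|ne2] := eqVneq q (p.2, p.1); first by right.
  case/hasP: nbad; exists p => //; apply/hasP; exists q => //.
  by rewrite /bad /nt ntp ntq ne1 ne2.
have [x [y [xab ycd xy]]] := trivial_link ntp ntq ne1 ne2.
have [s1 ps1] : exists s1, perm_eq s [:: (a, b), (c, d) & s1].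
  exists (rem (c, d) (rem (a, b) s)).
  apply: perm_trans (perm_to_rem ps) _; rewrite perm_cons.
  apply: perm_to_rem; move: qs; rewrite (perm_mem (perm_to_rem ps)).
  by rewrite inE (negbTE ne1).
have [||s2 [z2 e2 l2 h2]] := IHn [:: (x, y), (x, y) & s1].
- have /andP[_ /eqP w1] := xy.
  move: lt_n; rewrite (permP ps1) /= ntp ntq /nt /nontrivial_edge /= w1 andbF.
  by rewrite /=; clear; lia.
- move: es; rewrite (perm_all _ ps1) /= => /and3P[_ _ ->].
  by case/andP: xy => ->.
exists s2; split=> //; first by rewrite z2 (perm_size ps1).
(* The two copies put load two on [x] and on [y], which the weights of [a b] and of [c d] already
   reach there. *)
move=> v; apply: leq_trans (l2 v) _.
rewrite (load_perm _ ps1) !load_cons !addnA leq_add2r /=.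
case/andP: (xy) => axy /eqP ->.
have := adj_neq axy; case/andP: ntp => _ /=; case/andP: ntq => _ /=.
move: (wt _ _ _) (wt _ _ _) => k2 k1 k2P k1P nxy.
have [->|nvx] := eqVneq v x.
  have h : 0 < (x == a) + (x == b).
    by move: xab; rewrite !inE => /orP[]->; rewrite ?addn1.
  rewrite (negbTE nxy) !mul1n; apply: leq_trans (leq_addr _ _).
  exact: leq_mul k1P h.
have [->|_] := eqVneq v y; last by rewrite !mul1n.
have h : 0 < (y == c) + (y == d).
  by move: ycd; rewrite !inE => /orP[]->; rewrite ?addn1.
rewrite !mul1n; apply: leq_trans (leq_addl _ _).
exact: leq_mul k2P h.
Qed.

Hypothesis occ : forall C D, odd_walk trivial_edge C ->
  odd_walk trivial_edge D ->
  exists x y, [/\ x \in C, y \in D & trivial_edge x y].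
Hypothesis occ1 : forall C a b, odd_walk trivial_edge C ->
  nontrivial_edge G a b ->
  exists x y, [/\ x \in C, y \in [:: a; b] & trivial_edge x y].

Lemma odd_walk_neq0 C : odd_walk trivial_edge C -> exists x, x \in C.
Proof. by case: C => [|x C]; [case/andP | exists x; rewrite mem_head]. Qed.

(** The target [2 * t] is even, so parity absorbs the half unit lost at a leftover odd walk. *)
Lemma half_cover t u : packs t u \/
  exists c : T -> nat, (forall x y, trivial_edge x y -> 2 <= c x + c y) /\
    \sum_v u v * c v < 2 * t.
Proof.
have [[Y [eY lY zY]]|[C [wC hC]]|?] := half_integral_packing u occ (2 * t).
- left; apply: (packs_leq (trivial_all_adj eY) lY); lia.
- left; have [x /hC[Y [eY lY zY]]] := odd_walk_neq0 wC.
  apply: (packs_leq (trivial_all_adj eY)); last by lia.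
  by move=> v; apply: leq_trans (lY v); apply: leq_addr.
- by right.
Qed.

(** Here [r / m] is the fractional part of the nontrivial edge [a b]. If trivial edges fail to reach
    [t], it is at least one half, and one unit can be set aside at [a] and at [b] for linking a
    leftover odd walk. *)
Lemma packs_div_one_nontrivial t m r u Y a b :
    nontrivial_edge G a b -> r < m ->
    all (fun q => trivial_edge q.1 q.2) Y ->
    (forall v, load Y v + wt G a b * r * ((v == a) + (v == b)) <= m * u v) ->
    size Y + r = t * m ->
  packs t u.
Proof.
move=> ab lt_rm eY lY zY; case/andP: (ab) => adj_ab p_gt1.
set p := wt G a b in lY p_gt1.
have neq_ab := adj_neq adj_ab.
pose d v : nat := (v == a) + (v == b).
have sum_d (c : T -> nat) : \sum_v d v * c v = c a + c b.
  rewrite -(sum_delta a) -(sum_delta b) -big_split.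
  by apply: eq_bigr => v _; rewrite mulnDl.
have dual (c : T -> nat) : (forall x y, trivial_edge x y -> 2 <= c x + c y) ->
    2 * size Y + p * r * (c a + c b) <= m * \sum_v u v * c v.
  move=> /(dual_bound eY) le_c; rewrite -sum_d.
  apply: leq_trans (leq_add le_c (leqnn _)) _.
  rewrite !big_distrr -big_split; apply: leq_sum => v _ /=.
  by rewrite !mulnA -mulnDl leq_mul2r lY orbT.
have [//|[c [/dual le_c lt_c]]] := half_cover t u.
(* Duality against a cover of value below [2 * t]. As the weight is at least two, [a] and [b] then
   carry load at least [m], hence have capacity at least one. *)
have le_m2r : m <= 2 * r by nia.
have u_gt0 v : d v <= u v.
  have := lY v; rewrite -/(d v).
  have : d v <= 1.
    rewrite /d; have [->|_] := eqVneq v a; last by case: (v == b).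
    by rewrite (negbTE neq_ab).
  by case: (d v) => [|[|]] //; nia.
pose u' v := u v - d v.
have uE v : u v = u' v + d v by rewrite subnK.
(* With target [2 * t - 1] a packing still has [t] edges by parity, while next to a leftover walk it
   may lack one edge, which the link from the walk to [a] or [b] supplies. *)
have [[Y' [eY' lY' zY']]|[C [wC hC]]|[c' [/dual le_c' lt_c']]] :=
  half_integral_packing u' occ (2 * t).-1.
- apply: (packs_leq (trivial_all_adj eY')); last by lia.
  by move=> v; apply: leq_trans (lY' v) _; rewrite uE leq_addr.
- have [x [y [xC yab xy]]] := occ1 wC ab.
  have [Y' [eY' lY' zY']] := hC x xC.
  apply: (@packs_leq _ _ ((x, y) :: Y')).
  + by rewrite /= trivial_all_adj // andbT; case/andP: xy.
  + move=> v; rewrite load_cons uE /=; case/andP: xy => _ /eqP->.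
    have : (v == y) <= d v.
      move: yab; rewrite !inE /d.
      by case/orP=> /eqP->; rewrite ?leq_addr ?leq_addl.
    by move: (lY' v); move: (u' v) (d v) (load _ v) => ? ? ?; clear; lia.
  + by rewrite /=; clear -zY'; lia.
(* A cover for [u'] of value at most [2 * t - 2] would force [m <= r] by duality. *)
- move: le_c'; under eq_bigr do rewrite uE mulnDl.
  rewrite big_split /= sum_d; move: (\sum_v _) lt_c' => S lt_S.
  move: (c' a + c' b) => k le_k.
  have h1 : m * k <= p * r * k by rewrite leq_mul2r; nia.
  have h2 : m * S + 2 * m <= m * (2 * t) by nia.
  by exfalso; nia.
Qed.

(** After the exchanges all nontrivial edges are copies of one edge [a b]. Dividing their number by
    [m], the quotient is kept as whole copies of [a b] and the remainder is the fractional part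
    treated before. *)
Lemma packs_div t m u :
  0 < m -> packs (t * m) (fun v => m * u v) -> packs t u.
Proof.
move=> m_gt0 [s0 /packingP[z0 e0 l0]].
have [s [zs es ls one]] := exchange_nontrivial e0.
pose nt (q : T * T) := nontrivial_edge G q.1 q.2.
have pf : perm_eq s (filter nt s ++ filter (predC nt) s).
  by rewrite perm_sym perm_filterC.
have eY : all (fun q => trivial_edge q.1 q.2) (filter (predC nt) s).
  apply/allP=> q; rewrite mem_filter => /andP[/= nq /(allP es)].
  by rewrite edge_cases [nontrivial_edge _ _ _](negbTE nq) orbF.
have lY v : load (filter nt s) v + load (filter (predC nt) s) v <= m * u v.
  by rewrite -load_cat -(load_perm _ pf) (leq_trans (ls v) (l0 v)).
have zY : size (filter nt s) + size (filter (predC nt) s) = t * m.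
  by rewrite -size_cat -(perm_size pf) zs.
case def_N: (filter nt s) => [|[a b] N].
  (* With trivial edges only, weak duality excludes a cover of value below [2 * t]. *)
  have [//|[c [cov lt_c]]] := half_cover t u.
  have := dual_bound eY cov.
  have le : \sum_v load (filter (predC nt) s) v * c v <= m * \sum_v u v * c v.
    rewrite big_distrr; apply: leq_sum => v _; rewrite /= mulnA leq_mul2r.
    by rewrite (leq_trans _ (lY v)) ?orbT ?leq_addl.
  by move: zY; rewrite def_N /=; nia.
have [abs ab] : (a, b) \in s /\ nt (a, b).
  by apply/andP; rewrite andbC -mem_filter def_N mem_head.
set r := size (filter nt s) in zY.
have lN v : load (filter nt s) v = wt G a b * r * ((v == a) + (v == b)).
  rewrite /r; clear lY zY r; have: all nt (filter nt s) by exact: filter_all.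
  have: {subset filter nt s <= s} by move=> q; rewrite mem_filter => /andP[].
  elim: (filter nt s) {def_N} => [|q s' IHs'] sub_s'.
    by rewrite load_nil muln0.
  rewrite [all _ _]/= => /andP[ntq nts'].
  rewrite load_cons IHs' //; last first.
    by move=> q' s'q'; apply: sub_s'; rewrite inE s'q' orbT.
  have [->|->] := one (a, b) q abs (sub_s' _ (mem_head _ _)) ab ntq.
    by rewrite /=; clear; lia.
  rewrite /= (wt_sym (x := b)) ?(adj_sym _ b); last by case/andP: ab.
  by clear; lia.
clear def_N N.
pose q := r %/ m; pose r' := r %% m.
have def_r : r = q * m + r' by exact: divn_eq.
have le_qt : q <= t by nia.
pose d v : nat := (v == a) + (v == b).
have le_du v : wt G a b * q * d v <= u v.
  have := lY v; rewrite lN -/(d v) => le; rewrite -(leq_pmul2l m_gt0).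
  apply: leq_trans (leq_trans (leq_addr _ _) le); rewrite def_r; nia.
have [||||s' /packingP[zs' es' ls']] := @packs_div_one_nontrivial (t - q) m r'
    (fun v => u v - wt G a b * q * d v) (filter (predC nt) s) a b ab.
- by rewrite ltn_mod.
- by [].
- move=> v; have := lY v; rewrite lN -/(d v) def_r mulnBr; have := le_du v.
  set w := wt G a b; set dv := d v; set l := load _ _ => h1 h2.
  have -> : m * (w * q * dv) = w * (q * m) * dv by lia.
  by rewrite leq_subRL; nia.
- rewrite mulnBl; nia.
exists (nseq q (a, b) ++ s'); apply/packingP; split.
- by rewrite size_cat size_nseq zs' subnKC.
- by rewrite all_cat es' all_nseq andbT; case/andP: ab => ->; rewrite orbT.
move=> v; rewrite load_cat load_nseq /= -/(d v).
by have := ls' v; have := le_du v; lia.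
Qed.

End Packings.

(** * Configurations as lists of vertices of the whole graph *)

Section InducedConfigurations.
Variables (T : finType) (G : wgraph T).

Lemma spans_induced (U : {set T}) (s : seq {x : T | x \in U}) :
  {subset U <= map val s} -> uniq (map val s) -> spans s.
Proof.
move=> sU; rewrite (map_inj_uniq val_inj) => Us; split=> // x.
by rewrite -(mem_map val_inj); apply: sU; apply: valP.
Qed.

Lemma seq_lift (U : {set T}) (s : seq T) : {subset s <= U} ->
  exists s' : seq {x : T | x \in U}, map val s' = s.
Proof.
elim: s => [|x s IHs] sU; first by exists [::].
have [|s' def_s'] := IHs; first by move=> y ys; apply: sU; rewrite inE ys orbT.
have xU : x \in U by apply: sU; rewrite mem_head.
by exists (Sub x xU :: s'); rewrite /= def_s'.
Qed.

Lemma set_seq_lift (s : seq T) :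
  exists s' : seq {x : T | x \in [set y in s]}, map val s' = s.
Proof. by apply: seq_lift => x; rewrite inE. Qed.

Lemma odd_cycle_induced (U : {set T}) (c : seq {x : T | x \in U}) :
  odd_cycle (induced G U) c <-> odd_cycle G (map val c).
Proof.
rewrite /odd_cycle size_map (map_inj_uniq val_inj).
split=> -[Uc szc oddc ec]; split=> //.
  move=> _ _ /mapP[x xc ->] /mapP[y yc ->].
  by rewrite !(next_map val_inj) // !val_eqE -ec.
move=> x y xc yc; have := ec _ _ (map_f val xc) (map_f val yc).
by rewrite !(next_map val_inj) // !val_eqE.
Qed.

(** This form and its analogues below replace the subtype of an induced subgraph by vertices of [G];
    the set of listed vertices serves as [U]. *)
Lemma induced_F1P : has_induced G isF1 <-> exists a b c,
  [/\ uniq [:: a; b; c], nontrivial_edge G a b, nontrivial_edge G b c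
    & ~~ adj G a c].
Proof.
split=> [[U [a [b [c [[Us _] ab bc ac]]]]]|[a [b [c [Us]]]]].
  exists (val a), (val b), (val c); split=> //.
have [s] := set_seq_lift [:: a; b; c].
case: s => [|a' [|b' [|c' [|? ?]]]] //= [def_a def_b def_c] ab bc ac.
exists [set y in [:: a; b; c]], a', b', c'; rewrite /nontrivial_edge /=.
rewrite def_a def_b def_c; split=> //.
by apply: spans_induced; rewrite /= def_a def_b def_c // => x; rewrite inE.
Qed.

Lemma induced_F2P : has_induced G isF2 <-> exists a b c,
  [/\ uniq [:: a; b; c], nontrivial_edge G a b, nontrivial_edge G b c
    & nontrivial_edge G a c].
Proof.
split=> [[U [a [b [c [[Us _] ab bc ac]]]]]|[a [b [c [Us]]]]].
  exists (val a), (val b), (val c); split=> //.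
have [s] := set_seq_lift [:: a; b; c].
case: s => [|a' [|b' [|c' [|? ?]]]] //= [def_a def_b def_c] ab bc ac.
exists [set y in [:: a; b; c]], a', b', c'; rewrite /nontrivial_edge /=.
rewrite def_a def_b def_c; split=> //.
by apply: spans_induced; rewrite /= def_a def_b def_c // => x; rewrite inE.
Qed.

Lemma induced_F3P : has_induced G isF3 <-> exists a b c d,
  [/\ uniq [:: a; b; c; d], nontrivial_edge G a b, nontrivial_edge G c d
    & {in [:: a; b] & [:: c; d], forall x y, ~~ adj G x y}].
Proof.
split=> [[U [a [b [c [d [[Us _] ab cd nadj]]]]]]|[a [b [c [d [Us]]]]]].
  exists (val a), (val b), (val c), (val d); split=> //.
  move=> x y; rewrite -[[:: val a; _]]/(map val [:: a; b]).
  rewrite -[[:: val c; _]]/(map val [:: c; d]).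
  by move=> /mapP[x' x'ab ->] /mapP[y' y'cd ->]; apply: nadj.
have [s] := set_seq_lift [:: a; b; c; d].
case: s => [|a' [|b' [|c' [|d' [|? ?]]]]] //= [def_a def_b def_c def_d].
move=> ab cd nadj.
exists [set y in [:: a; b; c; d]], a', b', c', d'; rewrite /nontrivial_edge /=.
rewrite def_a def_b def_c def_d; split=> //.
  apply: spans_induced; rewrite /= def_a def_b def_c def_d // => x.
  by rewrite inE.
move=> x y /(map_f val) /= xab /(map_f val) /= ycd.
by move: xab ycd; rewrite def_a def_b def_c def_d; apply: nadj.
Qed.

Lemma induced_F4P : has_induced G isF4 <-> exists c a b,
  [/\ uniq (c ++ [:: a; b]), odd_cycle G c, nontrivial_edge G a b
    & {in c & [:: a; b], forall x y, ~~ adj G x y}].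
Proof.
split=> [[U [c [a [b [[Us _] oc ab nadj]]]]]|[c [a [b [Us]]]]].
  exists (map val c), (val a), (val b); split=> //.
  - rewrite -[[:: val a; _]]/(map val [:: a; b]) -map_cat.
    by rewrite (map_inj_uniq val_inj).
  - exact/odd_cycle_induced.
  move=> x y; rewrite -[[:: val a; _]]/(map val [:: a; b]).
  by move=> /mapP[x' x'c ->] /mapP[y' y'ab ->]; apply: nadj.
move=> oc ab nadj; pose U := [set y in c ++ [:: a; b]].
have [c' def_c] : exists c' : seq {x : T | x \in U}, map val c' = c.
  by apply: seq_lift => x xc; rewrite inE mem_cat xc.
have [s] : exists s : seq {x : T | x \in U}, map val s = [:: a; b].
  by apply: seq_lift => x xab; rewrite inE mem_cat xab orbT.
case: s => [|a' [|b' [|? ?]]] //= [def_a def_b].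
exists U, c', a', b'; rewrite /nontrivial_edge /= def_a def_b; split=> //.
  apply: spans_induced; rewrite map_cat /= def_a def_b def_c //.
  by move=> x; rewrite inE.
  by apply/odd_cycle_induced; rewrite def_c.
move=> x y /(map_f val) /= xc /(map_f val) /= yab.
by move: xc yab; rewrite def_a def_b def_c; apply: nadj.
Qed.

Lemma induced_F5P : has_induced G isF5 <-> exists c d,
  [/\ uniq (c ++ d), odd_cycle G c, odd_cycle G d
    & {in c & d, forall x y, adj G x y -> nontrivial_edge G x y}].
Proof.
split=> [[U [c [d [[Us _] oc od nadj]]]]|[c [d [Us oc od nadj]]]].
  exists (map val c), (map val d); split; try exact/odd_cycle_induced.
    by rewrite -map_cat (map_inj_uniq val_inj).
  by move=> x y /mapP[x' x'c ->] /mapP[y' y'd ->]; apply: nadj.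
pose U := [set y in c ++ d].
have [c' def_c] : exists c' : seq {x : T | x \in U}, map val c' = c.
  by apply: seq_lift => x xc; rewrite inE mem_cat xc.
have [d' def_d] : exists d' : seq {x : T | x \in U}, map val d' = d.
  by apply: seq_lift => x xd; rewrite inE mem_cat xd orbT.
exists U, c', d'; split.
- apply: spans_induced; rewrite map_cat def_c def_d //.
  by move=> x; rewrite inE.
- by apply/odd_cycle_induced; rewrite def_c.
- by apply/odd_cycle_induced; rewrite def_d.
move=> x y /(map_f val) /= xc /(map_f val) /= yd.
by move: xc yd; rewrite def_c def_d; apply: nadj.
Qed.

(** Chords are sought in [adj], as [odd_cycle] demands, and not only among trivial edges; the
    resulting cycle may therefore use nontrivial edges. *)
Lemma odd_walk_cycle C : odd_walk (trivial_edge G) C ->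
  exists c, {subset c <= C} /\ odd_cycle G c.
Proof.
case/andP=> cC oddC.
have [c [sc Uc szc oddc ec]] : exists c', [/\ {subset c' <= C}, uniq c',
    3 <= size c', odd (size c') &
    {in c' &, forall x y, adj G x y = (y == next c' x) || (x == next c' y)}].
  apply: (odd_walk_chordless (adj_sym G) (@adj_irr _ G)).
  by rewrite /odd_walk oddC (sub_cycle _ cC) // => x y /andP[].
by exists c; split.
Qed.

(** Supplies the trivial link when a walk meets another walk or a nontrivial edge at [x]. *)
Lemma odd_walk_next C x : odd_walk (trivial_edge G) C -> x \in C ->
  next C x \in C /\ trivial_edge G (next C x) x.
Proof.
move=> /andP[cC _] xC; rewrite mem_next; split=> //.
by rewrite trivial_edge_sym next_cycle.
Qed.

Lemma uniq_cat_disjoint (c d : seq T) :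
  uniq c -> uniq d -> (forall x, x \in c -> x \notin d) -> uniq (c ++ d).
Proof.
move=> Uc Ud cd; rewrite cat_uniq Uc Ud andbT /=.
by apply/hasPn=> x xd; apply: contraL xd => /cd.
Qed.

(** * Links in a graph without configurations *)

Section NoConfiguration.
Hypotheses (noF1 : ~ has_induced G isF1) (noF2 : ~ has_induced G isF2).
Hypotheses (noF3 : ~ has_induced G isF3) (noF4 : ~ has_induced G isF4).
Hypothesis noF5 : ~ has_induced G isF5.

Lemma noF_star a b c :
  a != c -> nontrivial_edge G a b -> nontrivial_edge G b c ->
  trivial_edge G a c.
Proof.
move=> nac ab bc; have [adj_ab _] := andP ab; have [adj_bc _] := andP bc.
have Us : uniq [:: a; b; c].
  by rewrite /= !inE negb_or nac (adj_neq adj_ab) (adj_neq adj_bc).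
have [|nadj] := boolP (adj G a c); last first.
  by case: noF1; apply/induced_F1P; exists a, b, c.
rewrite edge_cases => /orP[//|ac].
by case: noF2; apply/induced_F2P; exists a, b, c.
Qed.

Lemma noF_link a b c d :
  nontrivial_edge G a b -> nontrivial_edge G c d -> uniq [:: a; b; c; d] ->
  exists x y, [/\ x \in [:: a; b], y \in [:: c; d] & adj G x y].
Proof.
move=> ab cd Us.
have [/hasP[x xab /hasP[y ycd xy]]|nadj] :=
    boolP (has (fun x => has (adj G x) [:: c; d]) [:: a; b]).
  by exists x, y.
case: noF3; apply/induced_F3P; exists a, b, c, d; split=> // x y xab ycd.
by apply: contra nadj => xy; apply/hasP; exists x => //; apply/hasP; exists y.
Qed.

(** Chordless odd cycles inside the walks either share a vertex, where a walk edge is the link, or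
    are disjoint and would form $F_5$ without a trivial edge between them. *)
Lemma noF_odd_walks C D :
  odd_walk (trivial_edge G) C -> odd_walk (trivial_edge G) D ->
  exists x y, [/\ x \in C, y \in D & trivial_edge G x y].
Proof.
move=> wC wD; have [c [sc oc]] := odd_walk_cycle wC.
have [d [sd od]] := odd_walk_cycle wD.
have [/hasP[x xc xd]|/hasPn cd] := boolP (has (mem d) c).
  have [nC tx] := odd_walk_next wC (sc x xc).
  by exists (next C x), x; split=> //; apply: sd.
have [/hasP[x xc /hasP[y yd xy]]|nadj] :=
    boolP (has (fun x => has (trivial_edge G x) d) c).
  by exists x, y; split; rewrite ?sc ?sd.
case: noF5; apply/induced_F5P; exists c, d; split=> //.
  by apply: uniq_cat_disjoint; [case: oc | case: od |].
move=> x y xc yd; rewrite edge_cases => /orP[xy|//]; case/hasP: nadj.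
by exists x => //; apply/hasP; exists y.
Qed.

(** Absence of $F_4$ gives some edge from the cycle to [a b] if they are disjoint; if it is
    nontrivial, [noF_star] yields a trivial edge to the other end of [a b]. *)
Lemma noF_odd_walk_edge C a b :
  odd_walk (trivial_edge G) C -> nontrivial_edge G a b ->
  exists x y, [/\ x \in C, y \in [:: a; b] & trivial_edge G x y].
Proof.
move=> wC ab; have [c [sc oc]] := odd_walk_cycle wC.
have [adj_ab _] := andP ab.
have [/hasP[x xc xab]|/hasPn cab] := boolP (has (mem [:: a; b]) c).
  have [nC tx] := odd_walk_next wC (sc x xc).
  by exists (next C x), x.
have [/hasP[x xc /hasP[y yab xy]]|nadj] :=
    boolP (has (fun x => has (adj G x) [:: a; b]) c); last first.
  case: noF4; apply/induced_F4P; exists c, a, b; split=> //.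
    apply: uniq_cat_disjoint; [by case: oc | | by []].
    by rewrite /= inE (adj_neq adj_ab).
  move=> x y xc yab; apply: contra nadj => xy; apply/hasP; exists x => //.
  by apply/hasP; exists y.
move: (xy); rewrite edge_cases => /orP[txy|ntxy].
  by exists x, y; rewrite sc.
have := cab x xc; rewrite /= !inE negb_or => /andP[nxa nxb].
move: yab; rewrite !inE => /orP[]/eqP def_y; rewrite {y}def_y in ntxy xy.
  exists x, b; rewrite sc // !inE eqxx orbT; split=> //.
  exact: noF_star nxb ntxy ab.
exists x, a; rewrite sc // !inE eqxx; split=> //.
by apply: noF_star nxa ntxy _; rewrite nontrivial_edge_sym.
Qed.

Lemma noF_packs_div t m (u : T -> nat) :
  0 < m -> packs G (t * m) (fun v => m * u v) -> packs G t u.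
Proof.
exact: (packs_div noF_star noF_link noF_odd_walks noF_odd_walk_edge).
Qed.

End NoConfiguration.

End InducedConfigurations.

(** * Configurations obstruct halving *)

Section Halving.
Variables (T : finType) (G : wgraph T).

Lemma sum_eq_count (c : seq T) x : \sum_(v <- c) (v == x) = count_mem x c.
Proof. by elim: c => [|y c IHc]; rewrite ?big_nil // big_cons IHc. Qed.

Lemma pair_edge_wt a b x y : adj G a b -> adj G x y ->
  x \in [:: a; b] -> y \in [:: a; b] -> wt G x y = wt G a b.
Proof.
move=> ab xy; rewrite !inE => /orP[]/eqP def_x /orP[]/eqP def_y; subst x y.
- by rewrite adj_irr in xy.
- by [].
- by rewrite (wt_sym xy).
- by rewrite adj_irr in xy.
Qed.

Lemma load_ge (s : seq (T * T)) q : q \in s ->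
  wt G q.1 q.2 <= load G s q.1 /\ wt G q.1 q.2 <= load G s q.2.
Proof.
move=> qs; rewrite !(load_perm G _ (perm_to_rem qs)) !load_cons !eqxx.
by split; apply: leq_trans (leq_addr _ _); rewrite leq_pmulr ?addn1.
Qed.

Lemma inner_load (c : seq T) s : uniq c -> all (fun q => adj G q.1 q.2) s ->
  2 * count (fun q => (q.1 \in c) && (q.2 \in c)) s <= \sum_(v <- c) load G s v.
Proof.
move=> Uc; elim: s => [|[x y] s IHs] /=; first by rewrite muln0.
case/andP=> xy /IHs IH; under eq_bigr do rewrite load_cons /=.
rewrite big_split mulnDr leq_add //=.
have [/andP[xc yc]|//] := boolP ((x \in c) && (y \in c)).
rewrite -big_distrr big_split /= muln1.
rewrite !sum_eq_count !count_uniq_mem // xc yc.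
by rewrite -{1}[2]mul1n leq_mul2r (wt_gt0 xy) orbT.
Qed.

(** With capacity one, the edges inside an odd vertex set form a matching, which misses a vertex by
    parity. *)
Lemma inner_count (c : seq T) s :
    uniq c -> odd (size c) -> all (fun q => adj G q.1 q.2) s ->
    {in c, forall v, load G s v <= 1} ->
  2 * count (fun q => (q.1 \in c) && (q.2 \in c)) s < size c.
Proof.
move=> Uc oddc es lc; rewrite ltn_neqAle.
apply/andP; split.
  by apply: contraTneq oddc => <-; rewrite mul2n odd_double.
apply: leq_trans (inner_load Uc es) _; rewrite -sum1_size !big_seq.
exact: leq_sum.
Qed.

Definition cycle_edges (c : seq T) : seq (T * T) :=
  [seq (x, next c x) | x <- c].

Lemma cycle_edges_load c v : uniq c ->
  (forall x, x \in c -> wt G x (next c x) = 1) ->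
  load G (cycle_edges c) v <= 2 * (v \in c).
Proof.
move=> Uc wc; rewrite /load big_map big_seq.
under eq_bigr => x xc do rewrite /= wc // mul1n.
rewrite -big_seq big_split mul2n -addnn /= leq_add //.
  under eq_bigr do rewrite eq_sym; rewrite sum_eq_count count_uniq_mem //.
under eq_bigr do rewrite eq_sym.
rewrite -(big_map (next c) predT (fun x => nat_of_bool (x == v))) sum_eq_count.
rewrite count_uniq_mem; last by rewrite (map_inj_uniq (can_inj (prev_next Uc))).
by case: mapP => // -[x xc ->]; rewrite mem_next xc.
Qed.

Lemma odd_cycle_next c x : odd_cycle G c -> x \in c -> adj G x (next c x).
Proof. by case=> _ _ _ ec xc; rewrite ec ?mem_next // eqxx. Qed.

Lemma cycle_edges_adj c : odd_cycle G c ->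
  all (fun q => adj G q.1 q.2) (cycle_edges c).
Proof.
by move=> oc; rewrite all_map; apply/allP=> x; apply: odd_cycle_next.
Qed.

Hypothesis halve : forall t (u : T -> nat),
  0 < t -> packs G (t * 2) (fun v => 2 * u v) -> packs G t u.

(** Two edges fit into twice the rounded-up half load, so halving must make one whole edge fit into
    it. *)
Lemma halve_two_edges a b c d : adj G a b -> adj G c d ->
  exists x y, [/\ adj G x y,
    wt G x y <= (load G [:: (a, b); (c, d)] x).+1 %/ 2 &
    wt G x y <= (load G [:: (a, b); (c, d)] y).+1 %/ 2].
Proof.
move=> ab cd; pose u v := (load G [:: (a, b); (c, d)] v).+1 %/ 2.
have [||s /packingP[]] := @halve 1 u => //.
  exists [:: (a, b); (c, d)]; apply/packingP; split=> //=.
    by rewrite ab cd.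
  by move=> v; rewrite /u; lia.
case: s => [|[x y] [|? ?]] //= _; rewrite andbT => xy ls; exists x, y.
have [wx wy] := load_ge (mem_head (x, y) [::]).
by split=> //; [apply: leq_trans (ls x) | apply: leq_trans (ls y)].
Qed.

(** The half loads at [a] and [c] are too small for [a b] and [b c], whose weights exceed one, and
    [a c], if present, is at least as heavy as [a b]. The conditional form serves both $F_1$ and
    $F_2$. *)
Lemma halve_star a b c : uniq [:: a; b; c] ->
    nontrivial_edge G a b -> nontrivial_edge G b c ->
  ~ (adj G a c -> wt G a b <= wt G a c).
Proof.
rewrite /= !inE negb_or andbT => /andP[/andP[nab nac] nbc].
move=> /andP[ab p_gt1] /andP[bc q_gt1] le_ac.
have [x [y [xy]]] := halve_two_edges ab bc.
set l := load G _.
have lE v : l v =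
    wt G a b * ((v == a) + (v == b)) + wt G b c * ((v == b) + (v == c)).
  by rewrite /l !load_cons load_nil addn0.
have w_gt0 := wt_gt0 xy.
have la : l a = wt G a b.
  by rewrite lE eqxx (negbTE nab) (negbTE nac) muln0 addn0 muln1.
have lc : l c = wt G b c.
  rewrite lE eqxx eq_sym (negbTE nac) eq_sym (negbTE nbc) muln0.
  by rewrite muln1.
have lP v : 0 < (l v).+1 %/ 2 -> [\/ v = a, v = b | v = c].
  rewrite lE; have [->|_] := eqVneq v a; first by constructor 1.
  have [->|_] := eqVneq v b; first by constructor 2.
  have [->|_] := eqVneq v c; first by constructor 3.
  by rewrite !muln0.
move=> lx ly; case: (lP x (leq_trans w_gt0 lx)) => def_x;
  case: (lP y (leq_trans w_gt0 ly)) => def_y; subst x y;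
  rewrite ?adj_irr // in xy; rewrite ?la ?lc in lx ly.
- by lia.
- by have := le_ac xy; lia.
- by rewrite (wt_sym xy) in lx ly; lia.
- by lia.
- by rewrite (wt_sym xy) in lx ly; rewrite adj_sym in xy; have := le_ac xy; lia.
- by rewrite (wt_sym xy) in lx; lia.
Qed.

Lemma halve_noF1 : ~ has_induced G isF1.
Proof.
case/induced_F1P=> a [b [c [Us ab bc nac]]].
by apply: (halve_star Us ab bc); rewrite (negbTE nac).
Qed.

Lemma halve_noF2 : ~ has_induced G isF2.
Proof.
case/induced_F2P=> a [b [c [Us ab bc ac]]].
(* The lighter of the two edges at [a] takes the role of [a b]. *)
have [le_ac|lt_ac] := leqP (wt G a b) (wt G a c).
  exact: (halve_star Us ab bc).
have Us' : uniq [:: a; c; b].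
  move: Us; rewrite /= !inE !negb_or [c == b]eq_sym.
  by case/and3P=> /andP[-> ->] ->.
apply: (halve_star Us' ac); first by rewrite nontrivial_edge_sym.
by move=> _; apply: ltnW.
Qed.

(** Each vertex receives half the weight of its edge, rounded up, which is less than that weight; no
    other edge is available. *)
Lemma halve_noF3 : ~ has_induced G isF3.
Proof.
case/induced_F3P=> a [b [c [d [Us ab cd nadj]]]].
move: ab cd => /andP[ab p_gt1] /andP[cd q_gt1].
have [x [y [xy]]] := halve_two_edges ab cd.
set l := load G _.
have lE v : l v =
    wt G a b * ((v == a) + (v == b)) + wt G c d * ((v == c) + (v == d)).
  by rewrite /l !load_cons load_nil addn0.
have lab v : v \in [:: a; b] -> l v = wt G a b.
  rewrite lE; move: Us; rewrite /= !inE !negb_or => /and4P[/and3P[nab nac nad]].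
  move=> /andP[nbc nbd] _ _ /orP[]/eqP->; rewrite eqxx.
    by rewrite (negbTE nab) (negbTE nac) (negbTE nad) muln0 muln1 addn0.
  rewrite [b == a]eq_sym (negbTE nab) (negbTE nbc) (negbTE nbd) muln0.
  by rewrite muln1 addn0.
have lcd v : v \in [:: c; d] -> l v = wt G c d.
  rewrite lE; move: Us; rewrite /= !inE !negb_or => /and4P[/and3P[nab nac nad]].
  move=> /andP[nbc nbd] ncd _ /orP[]/eqP->;
    rewrite eqxx !(eq_sym _ a) !(eq_sym _ b).
    by rewrite (negbTE nac) (negbTE nbc) (negbTE ncd) muln0 muln1.
  by rewrite [d == c]eq_sym (negbTE nad) (negbTE nbd) (negbTE ncd) muln0 muln1.
have lP v : 0 < (l v).+1 %/ 2 -> (v \in [:: a; b]) || (v \in [:: c; d]).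
  by rewrite lE !inE; do 4!case: eqP => //=; rewrite !muln0.
move=> lx ly; have w_gt0 := wt_gt0 xy.
have xP := lP x (leq_trans w_gt0 lx); have yP := lP y (leq_trans w_gt0 ly).
case/orP: xP => xP; case/orP: yP => yP.
- by move: lx; rewrite lab // (pair_edge_wt ab xy) //; lia.
- by have := nadj _ _ xP yP; rewrite xy.
- by have := nadj _ _ yP xP; rewrite adj_sym xy.
- by move: lx; rewrite lcd // (pair_edge_wt cd xy) //; lia.
Qed.

(** Halving the cycle edges together with [a b] asks for [((size c).+1) %/ 2] edges. The capacities
    at [a] and [b] are too small for [a b], so all of them lie in the odd cycle, which has no
    room. *)
Lemma halve_noF4 : ~ has_induced G isF4.
Proof.
case/induced_F4P=> c [a [b [Us oc ab nadj]]].
have [adj_ab p_gt1] := andP ab.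
have [Uc _ oddc _] := oc.
have cab v : v \in c -> v \notin [:: a; b].
  move: Us; rewrite cat_uniq => /and3P[_ /hasPn cab _].
  by apply: contraL => /cab.
(* A nontrivial cycle edge would form $F_3$ with [a b]. *)
have wc x : x \in c -> wt G x (next c x) = 1.
  move=> xc; have xn := odd_cycle_next oc xc.
  have nc : next c x \in c by rewrite mem_next.
  move: (xn); rewrite edge_cases => /orP[/andP[_ /eqP//]|ntx].
  have [|y [z [yP zP yz]]] := noF_link halve_noF3 ntx ab.
    rewrite -[[:: _; _; _; _]]/([:: x; next c x] ++ [:: a; b]).
    apply: uniq_cat_disjoint; first by rewrite /= inE (adj_neq xn).
      by rewrite /= inE (adj_neq adj_ab).
    by move=> y; rewrite 2!inE => /orP[]/eqP->; apply: cab.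
  have yc : y \in c by move: yP; rewrite !inE => /orP[]/eqP->.
  by have := nadj _ _ yc zP; rewrite yz.
pose u v := (v \in c) + (load G [:: (a, b)] v).+1 %/ 2.
have ltE v : load G [:: (a, b)] v = wt G a b * ((v == a) + (v == b)).
  by rewrite load_cons load_nil addn0.
have uc v : v \in c -> u v = 1.
  move=> vc; rewrite /u vc ltE; have := cab v vc.
  by rewrite !inE negb_or => /andP[/negbTE-> /negbTE->]; rewrite muln0.
have uab v : v \in [:: a; b] -> u v = (wt G a b).+1 %/ 2.
  move=> vab; rewrite /u (negbTE (contraL (cab v) vab)) ltE add0n.
  move: vab; rewrite !inE => /orP[]/eqP->; rewrite eqxx.
    by rewrite (negbTE (adj_neq adj_ab)) muln1.
  by rewrite eq_sym (negbTE (adj_neq adj_ab)) muln1.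
have uP v : 0 < u v -> (v \in c) || (v \in [:: a; b]).
  rewrite /u ltE !inE; case: (v \in c) => //=.
  by do 2!case: eqP => //=; rewrite muln0.
have def_c : (size c).+1 = (size c).+1 %/ 2 * 2.
  by rewrite divnK // dvdn2 /= oddc.
have [||s /packingP[zs es ls]] := @halve ((size c).+1 %/ 2) u.
- by rewrite divn_gt0 //; case: oc => _ c3 _ _; lia.
- exists (cycle_edges c ++ [:: (a, b)]); apply/packingP; split.
  + by rewrite size_cat size_map addn1.
  + by rewrite all_cat cycle_edges_adj //= adj_ab.
  move=> v; rewrite load_cat /u mulnDr.
  by apply: leq_add; [apply: cycle_edges_load | lia].
have := inner_count Uc oddc es; rewrite (_ : count _ s = size s).
  rewrite zs mulnC -def_c ltnNge leqnSn => lt_c.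
  by have := lt_c (fun v vc => leq_trans (ls v) (eq_leq (uc v vc))).
apply/eqP; rewrite -all_count; apply/allP=> -[x y] xys /=.
have xy : adj G x y by exact: (allP es _ xys).
have [/= wx wy] := load_ge xys.
have {}wx := leq_trans wx (ls x); have {}wy := leq_trans wy (ls y).
have w_gt0 := wt_gt0 xy.
case/orP: (uP x (leq_trans w_gt0 wx)) => xP;
case/orP: (uP y (leq_trans w_gt0 wy)) => yP.
- by rewrite xP yP.
- by have := nadj _ _ xP yP; rewrite xy.
- by have := nadj _ _ yP xP; rewrite adj_sym xy.
- move: wx; rewrite (pair_edge_wt adj_ab xy) // (uab x xP).
  by clear -p_gt1; lia.
Qed.

(** Halving all edges of both cycles asks for a perfect matching of their union. Capacity one
    excludes the nontrivial edges between the cycles, and inside each odd cycle a vertex is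
    missed. *)
Lemma halve_noF5 : ~ has_induced G isF5.
Proof.
case/induced_F5P=> c [d [Us oc od nadj]].
have [Uc _ oddc _] := oc; have [Ud _ oddd _] := od.
have star := noF_star halve_noF1 halve_noF2.
have wcyc c' d' x : odd_cycle G c' -> odd_cycle G d' -> uniq (c' ++ d') ->
    {in c' & d', forall x y, adj G x y -> nontrivial_edge G x y} ->
    x \in c' -> wt G x (next c' x) = 1.
  move=> oc' od' Us' nadj' xc; have xn := odd_cycle_next oc' xc.
  have nc : next c' x \in c' by rewrite mem_next.
  have cd v : v \in d' -> v \notin c'.
    by move: Us'; rewrite cat_uniq => /and3P[_ /hasPn cd _]; apply: cd.
  move: (xn); rewrite edge_cases => /orP[/andP[_ /eqP//]|ntx].
  have [/hasP[z zd /hasP[y yP zy]]|nadjd] :=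
      boolP (has (fun z => has (adj G z) [:: x; next c' x]) d'); last first.
    case: halve_noF4; apply/induced_F4P; exists d', x, (next c' x); split=> //.
      apply: uniq_cat_disjoint; first by case: od'.
        by rewrite /= inE (adj_neq xn).
      move=> v vd; rewrite !inE; apply: contra (cd v vd).
      by case/orP=> /eqP->.
    move=> z y zd yP; apply: contra nadjd => zy; apply/hasP; exists z => //.
    by apply/hasP; exists y.
  (* The edge [z y1] is nontrivial, so [star] makes [z y2] trivial; but it joins the two cycles and
     must be nontrivial. *)
  have absurd y1 y2 : y1 \in c' -> y2 \in c' -> adj G z y1 ->
      nontrivial_edge G y1 y2 -> False.
    move=> y1c y2c; rewrite adj_sym => /(nadj' _ _ y1c zd) ntz nty.
    have nzy2 : z != y2 by apply: contraTneq y2c => <-; apply: cd.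
    rewrite nontrivial_edge_sym in ntz.
    have /andP[adj_zy2 /eqP w1] := star _ _ _ nzy2 ntz nty.
    rewrite adj_sym in adj_zy2; have /andP[_] := nadj' _ _ y2c zd adj_zy2.
    by rewrite (wt_sym adj_zy2) w1.
  move: yP; rewrite !inE => /orP[]/eqP def_y; rewrite {y}def_y in zy.
    by case: (absurd _ _ xc nc zy ntx).
  by rewrite nontrivial_edge_sym in ntx; case: (absurd _ _ nc xc zy ntx).
have wc x : x \in c -> wt G x (next c x) = 1 by apply: (wcyc c d x).
have wd x : x \in d -> wt G x (next d x) = 1.
  apply: (wcyc d c x) => //; first by rewrite uniq_catC.
  move=> y z yd zc; rewrite adj_sym nontrivial_edge_sym; exact: nadj.
pose u v := (v \in c) + (v \in d).
have u_le1 v : u v <= 1.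
  move: Us; rewrite cat_uniq => /and3P[_ /hasPn cd _]; rewrite /u.
  by have [/cd/negbTE->|_] := boolP (v \in d); [|case: (v \in c)].
have def_t : size c + size d = (size c + size d) %/ 2 * 2.
  by rewrite divnK // dvdn2 oddD oddc oddd.
have [||s /packingP[zs es ls]] := @halve ((size c + size d) %/ 2) u.
- rewrite divn_gt0 //; case: oc => _ c3 _ _.
  exact: leq_trans (ltnW c3) (leq_addr _ _).
- exists (cycle_edges c ++ cycle_edges d); apply/packingP; split.
  + by rewrite size_cat !size_map.
  + by rewrite all_cat !cycle_edges_adj.
  by move=> v; rewrite load_cat mulnDr leq_add // cycle_edges_load.
have ls1 v : load G s v <= 1 by apply: leq_trans (ls v) (u_le1 v).
have cntc := inner_count Uc oddc es (fun v _ => ls1 v).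
have cntd := inner_count Ud oddd es (fun v _ => ls1 v).
have := leq_add cntc (ltnW cntd); have <- : 2 * size s = size c + size d.
  by rewrite zs mulnC -def_t.
rewrite addSn -mulnDr ltn_pmul2l // ltnNge => /negP; apply.
rewrite -count_predUI; apply: leq_trans (leq_addr _ _).
rewrite -[X in X <= _](count_predT s) leq_eqVlt; apply/orP; left.
apply/eqP/eq_in_count=> -[x y] xys /=.
have xy : adj G x y by exact: (allP es _ xys).
have [/= wx wy] := load_ge xys.
have w_gt0 := wt_gt0 xy.
have w1 : wt G x y <= 1 by apply: leq_trans wx (ls1 x).
have uP v : 0 < u v -> (v \in c) || (v \in d).
  by rewrite /u; do 2!case: (_ \in _).
have ntF : ~~ nontrivial_edge G x y by rewrite negb_and -leqNgt w1 orbT.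
case/orP: (uP x (leq_trans w_gt0 (leq_trans wx (ls x)))) => xP;
case/orP: (uP y (leq_trans w_gt0 (leq_trans wy (ls y)))) => yP.
- by rewrite xP yP.
- by rewrite (nadj _ _ xP yP xy) in ntF.
- rewrite adj_sym in xy.
  by rewrite nontrivial_edge_sym (nadj _ _ yP xP xy) in ntF.
- by rewrite xP yP orbT.
Qed.

End Halving.

(** * Dickson's lemma *)

Section Dickson.

Definition infinite_set (P : nat -> Prop) := forall n, exists2 m, n <= m & P m.

(** [Q] keeps the indices at which [g] is minimal among all later indices of [P]; beyond any bound
    such a minimum is attained. *)
Lemma nondecreasing_subset (g : nat -> nat) P : infinite_set P ->
  exists Q : nat -> Prop, [/\ infinite_set Q, forall i, Q i -> P i
    & forall i j, Q i -> Q j -> i <= j -> g i <= g j].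
Proof.
move=> infP; pose Q i := P i /\ forall j, P j -> i <= j -> g i <= g j.
exists Q; split=> [n|i []//|i j [_ gi] [Pj _]]; last exact: gi.
have [m le_nm Pm] := infP n.
have [k] := ubnP (g m); elim: k m le_nm Pm => // k IHk m le_nm Pm lt_gk.
have [[j [Pj le_mj lt_j]]|min_m] :=
  classic (exists j, [/\ P j, m <= j & g j < g m]).
  by apply: (IHk j); [exact: leq_trans le_mj | | apply: leq_trans lt_j _].
exists m => //; split=> // j Pj le_mj; rewrite leqNgt; apply/negP=> lt_j.
by case: min_m; exists j.
Qed.

(** The index set is thinned out one coordinate at a time. *)
Lemma dickson (X : finType) (F : nat -> X -> nat) :
  exists i j, i < j /\ forall x, F i x <= F j x.
Proof.
suff [Q [infQ ndQ]] : exists Q, infinite_set Q /\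
    forall x, x \in enum X ->
      forall i j, Q i -> Q j -> i <= j -> F i x <= F j x.
  have [i _ Qi] := infQ 0; have [j lt_ij Qj] := infQ i.+1.
  by exists i, j; split=> // x; apply: ndQ; rewrite ?mem_enum // ltnW.
elim: (enum X) => [|x l [Q [infQ ndQ]]].
  by exists (fun _ => True); split=> // n; exists n.
have [Q' [infQ' sQ' nd']] := nondecreasing_subset (F^~ x) infQ.
exists Q'; split=> // y; rewrite inE => /orP[/eqP->//|yl] i j Qi Qj.
by apply: ndQ => //; apply: sQ'.
Qed.

End Dickson.

(** * Packings of multiples up to a bounded error *)

Section AsymptoticPackings.
Variables (T : finType) (G : wgraph T).
Implicit Types u v : T -> nat.

Lemma packs_le s t u v : s <= t -> (forall x, u x <= v x) ->
  packs G t u -> packs G s v.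
Proof.
move=> le_st le_uv [l /packingP[zl el ll]]; apply: packs_leq el _ _.
  by move=> x; apply: leq_trans (ll x) (le_uv x).
by rewrite zl.
Qed.

Lemma packs_add s t u v : packs G s u -> packs G t v ->
  packs G (s + t) (fun x => u x + v x).
Proof.
move=> [l /packingP[zl el ll]] [k /packingP[zk ek lk]]; exists (l ++ k).
apply/packingP; rewrite size_cat all_cat zl zk el ek; split=> // x.
by rewrite load_cat leq_add.
Qed.

Lemma packs0 u : packs G 0 u.
Proof. by exists [::]; apply/packingP; split=> // x; rewrite load_nil. Qed.

(* Dickson's lemma applied to multiplicities and slacks yields two packings, one
   contained in the other, and their difference witnesses the conclusion. *)
Lemma packs_asymptotic t u c :
    (forall N, packs G (t * N) (fun x => c x + N * u x)) ->
  exists2 m, 0 < m & packs G (t * m) (fun x => m * u x).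
Proof.
move=> packN; pose s N := xchoose (packN N).
have sP N : packing G (t * N) (fun x => c x + N * u x) (s N) by apply: xchooseP.
pose F N (x : (T * T) + T) := match x with
  | inl q => count_mem q (s N)
  | inr x => c x + N * u x - load G (s N) x end.
have [i [j [lt_ij le_F]]] := dickson F.
exists (j - i); first by rewrite subn_gt0.
have [s' subs pm] : exists2 s', subseq s' (s j) & perm_eq (s i) s'.
  by apply/count_subseqP => q; apply: (le_F (inl q)).
have [r pr] := perm_to_subseq subs.
have {}pr : perm_eq (s j) (s i ++ r).
  by apply: perm_trans pr _; rewrite perm_cat2r perm_sym.
case/packingP: (sP i) => zi ei li; case/packingP: (sP j) => zj ej lj.
exists r; apply/packingP; split.
- by have := perm_size pr; rewrite size_cat zi zj mulnBr => ->; rewrite addKn.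
- by move: ej; rewrite (perm_all _ pr) all_cat => /andP[].
(* The slack does not decrease from [i] to [j] and [c x] cancels, which bounds the load of [r]. *)
move=> x; have := le_F (inr x); rewrite /F.
have := li x; have := lj x; rewrite (load_perm _ _ pr) load_cat mulnBl.
by move: (load _ _ _) (load _ _ _) => l1 l2; lia.
Qed.

End AsymptoticPackings.

(** * Generated ideals *)

Section GeneratedIdeals.
Import GRing.Theory.
Local Open Scope ring_scope.
Variable R : comNzRingType.
Implicit Types (A I J : R -> Prop).

Lemma ideal_gen_mem A x y : A y -> ideal_gen A (x * y).
Proof.
move=> Ay; exists [:: (x, y)]; rewrite big_seq1; split=> // p.
by rewrite inE => /eqP->.
Qed.

Lemma ideal_gen_sum A (X : eqType) (r : seq X) (F : X -> R) :
  (forall i, i \in r -> ideal_gen A (F i)) -> ideal_gen A (\sum_(i <- r) F i).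
Proof.
move=> AF; rewrite big_seq.
apply: (big_ind (ideal_gen A)) => // [|x y [s [sA ->]] [s' [sA' ->]]].
  by exists [::]; rewrite big_nil.
exists (s ++ s'); rewrite big_cat; split=> // p.
by rewrite mem_cat => /orP[/sA|/sA'].
Qed.

End GeneratedIdeals.

(** * Powers of the edge ideal as monomial ideals *)

Section MonomialIdeals.
Import GRing.Theory.
Local Open Scope ring_scope.
Variables (k : fieldType) (n : nat) (G : wgraph 'I_n).
Implicit Types (f g : {mpoly k[n]}) (u : 'X_{1..n}).

(** Membership in the [t]-th power of the edge ideal, read off the support; [edge_ideal_expP] proves
    the equivalence. *)
Definition monos t f : Prop := forall u, u \in msupp f -> packs G t u.
Arguments monos t%_N f%_R.

Lemma monosX t u : monos t 'X_[u] <-> packs G t u.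
Proof.
split=> [|pu u']; first by apply; rewrite msuppX mem_head.
by rewrite msuppX inE => /eqP->.
Qed.

Lemma monos0 t : monos t 0.
Proof. by move=> u; rewrite msupp0. Qed.

Lemma monosD t f g : monos t f -> monos t g -> monos t (f + g).
Proof.
by move=> mf mg u /msuppD_le; rewrite mem_cat => /orP[/mf|/mg].
Qed.

Lemma monosN t f : monos t f -> monos t (- f).
Proof. by move=> mf u; rewrite (perm_mem (msuppN f)); apply: mf. Qed.

Lemma monosM s t f g : monos s f -> monos t g -> monos (s + t) (f * g).
Proof.
move=> mf mg u /msuppM_le/allpairsP[[u1 u2] /= [/mf pu1 /mg pu2 ->]].
by apply: packs_ext (packs_add pu1 pu2) => x; rewrite mnmDE.
Qed.

Lemma monos_le s t f : (s <= t)%N -> monos t f -> monos s f.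
Proof. by move=> le_st mf u /mf; apply: packs_le. Qed.

Lemma monos_triv f : monos 0 f.
Proof. by move=> u _; apply: packs0. Qed.

Lemma monosMl t f g : monos t g -> monos t (f * g).
Proof.
by move=> mg; rewrite -[t]add0n; apply: monosM mg; apply: monos_triv.
Qed.

Lemma monos_sum t (X : eqType) (r : seq X) (P : pred X)
    (F : X -> {mpoly k[n]}) :
  (forall i, i \in r -> P i -> monos t (F i)) ->
  monos t (\sum_(i <- r | P i) F i).
Proof.
move=> mF; rewrite big_seq_cond; apply: (big_ind (monos t)) => //.
- exact: monos0.
- exact: monosD.
by move=> i /andP[ir Pi]; apply: mF.
Qed.

Lemma monos_exp (t : nat) f N : monos t f -> monos (t * N) (f ^+ N).
Proof.
move=> mf; elim: N => [|N IHN]; first by rewrite muln0; apply: monos_triv.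
by rewrite exprS mulnS; apply: monosM.
Qed.

Lemma ideal_gen_monos (A : {mpoly k[n]} -> Prop) f :
  (forall u, u \in msupp f -> ideal_gen A 'X_[u]) -> ideal_gen A f.
Proof.
move=> Af; rewrite [f]mpolyE; apply: ideal_gen_sum => u /Af[s [sA ->]].
exists [seq (f@_u *: p.1, p.2) | p <- s]; split.
  by move=> _ /mapP[p ps ->]; apply: (sA p ps).
by rewrite scaler_sumr big_map; apply: eq_bigr => p _; rewrite -scalerAl.
Qed.

Definition mload (s : seq ('I_n * 'I_n)) : 'X_{1..n} :=
  [multinom load G s i | i < n].

Lemma edge_powerE i j :
  ('X_i * 'X_j) ^+ wt G i j = 'X_[mload [:: (i, j)]] :> {mpoly k[n]}.
Proof.
rewrite -mpolyXD mpolyXn; congr 'X_[_]; apply/mnmP=> x.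
by rewrite mulmnE mnmDE !mnm1E mnmE load_cons load_nil addn0 mulnC !(eq_sym x).
Qed.

Lemma packs_mload s : all (fun q => adj G q.1 q.2) s ->
  packs G (size s) (mload s).
Proof.
by move=> es; exists s; apply/packingP; split=> // x; rewrite mnmE.
Qed.

Lemma edge_idealP f : edge_ideal G f <-> monos 1 f.
Proof.
split=> [[s [sA ->]]|mf].
  apply: monos_sum => p /sA[i [j [ij ->]]] _; apply: monosMl.
  rewrite edge_powerE; apply/monosX.
  by apply: (@packs_mload [:: (i, j)]); rewrite /= ij.
apply: ideal_gen_monos => u /mf[[|[i j] [|? ?]] // /packingP[_ /andP[ij _] lu]].
have le_u : (mload [:: (i, j)] <= u)%MM by apply/mnm_lepP=> x; rewrite mnmE.
rewrite -(submK le_u) mpolyXD; apply: ideal_gen_mem.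
by exists i, j; rewrite edge_powerE.
Qed.

(** A packing of [s + t] edges is cut after its first [s] edges, and the second factor takes all the
    remaining exponent. *)
Lemma ideal_mulP s t (I J : {mpoly k[n]} -> Prop) f :
  (forall g, I g <-> monos s g) -> (forall g, J g <-> monos t g) ->
  ideal_mul I J f <-> monos (s + t) f.
Proof.
move=> IP JP; split=> [[r [rA ->]]|mf].
  apply: monos_sum => p /rA[a [b [/IP ma /JP mb ->]]] _.
  by apply: monosMl; apply: monosM.
apply: ideal_gen_monos => u /mf[l /packingP[zl el ll]].
move: el; rewrite -(cat_take_drop s l) all_cat => /andP[e1 e2].
have le_u : (mload (take s l) <= u)%MM.
  apply/mnm_lepP=> x; rewrite mnmE; apply: leq_trans (ll x).
  by rewrite -[in X in (_ <= X)%N](cat_take_drop s l) load_cat leq_addr.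
rewrite -[X in ideal_gen _ X]mul1r; apply: ideal_gen_mem.
exists 'X_[mload (take s l)], 'X_[u - mload (take s l)]; split.
- apply/IP/monosX; have := packs_mload e1.
  by rewrite size_takel // zl leq_addr.
- apply/JP/monosX; exists (drop s l); apply/packingP; split=> //.
    by rewrite size_drop zl addKn.
  move=> x; have /mnm_lepP/(_ x) := le_u; rewrite mnmBE mnmE => le_ux.
  rewrite leq_subRL //.
  by rewrite -load_cat cat_take_drop.
by rewrite -mpolyXD addmC submK.
Qed.

Lemma ideal_expP t (I : {mpoly k[n]} -> Prop) :
  (forall f, I f <-> monos t f) ->
  forall N f, ideal_exp I N f <-> monos (t * N) f.
Proof.
move=> IP; elim=> [|N IHN] f.
  by rewrite muln0; split=> // _; apply: monos_triv.
by rewrite mulnS; apply: ideal_mulP.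
Qed.

Lemma edge_ideal_expP t f : ideal_exp (edge_ideal G) t f <-> monos t f.
Proof.
by rewrite -[in X in _ <-> X](mul1n t); apply: ideal_expP edge_idealP t f.
Qed.

Lemma edge_ideal_exp_expP t N f :
  ideal_exp (ideal_exp (edge_ideal G) t) N f <-> monos (t * N) f.
Proof. exact/ideal_expP/edge_ideal_expP. Qed.

(** * Integral closedness when packings can be divided *)

Section Closed.
Hypothesis packs_divisible : forall t m (u : 'I_n -> nat),
  (0 < m)%N -> packs G (t * m)%N (fun x => m * u x)%N -> packs G t u.

(* Subtracting the leading term keeps [f] almost integral. *)
Lemma monos_almost_integral t c f : c != 0 ->
  (forall N, monos (t * N) (c * f ^+ N)) -> monos t f.
Proof.
move=> nzc; have [m] := ubnP (size (msupp f)); elim: m f => // m IHm f lt_m mf.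
have [->|nzf] := eqVneq f 0; first exact: monos0.
(* The leading exponent of [c * f ^+ N] is that of [c] plus [N] times that of [f], so
   [packs_asymptotic] and then division apply. *)
have lead_f : packs G t (mlead f).
  have [|m' m'_gt0] := @packs_asymptotic _ G t (mlead f) (mlead c); last first.
    exact: packs_divisible.
  move=> N; apply: packs_ext (mf N (mlead (c * f ^+ N)) _).
    by move=> x; rewrite mleadM ?expf_neq0 // mleadX // mnmDE mulmnE mulnC.
  by rewrite mlead_supp // mulf_neq0 ?expf_neq0.
pose g := mleadc f *: 'X_[mlead f].
have mg : monos t g by move=> u /msuppZ_le; apply/monosX: u.
have {1}-> : f = (f - g) + g by rewrite subrK.
apply: monosD => //; apply: IHm.
  rewrite (perm_size (msupp_rem f (mlead f))) size_rem ?mlead_supp //.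
  have := mlead_supp nzf; case: (msupp f) lt_m => //= *; lia.
(* In the binomial expansion each term pairs [c * f ^+ (N - i)] with [g ^+ i], and their orders add
   up to [t * N]. *)
move=> N; rewrite exprBn mulr_sumr; apply: monos_sum => i _ _.
rewrite -mulr_natr.
have -> : c * ((-1) ^+ i * f ^+ (N - i) * g ^+ i * 'C(N, i)%:R) =
  ((-1) ^+ i * 'C(N, i)%:R) * ((c * f ^+ (N - i)) * g ^+ i).
  by ring.
apply: monosMl; have le_iN : (i <= N)%N by rewrite -ltnS.
have -> : (t * N = t * (N - i) + t * i)%N by rewrite -mulnDr subnK.
by apply: monosM => //; apply: monos_exp.
Qed.

(** Integral elements are almost integral: for a generator [g] of the [t]-th power, the factor
    [g ^+ m.-1] works for all powers of [f]. *)
Lemma int_closure_monos t f : (0 < t)%N ->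
  int_closure (ideal_exp (edge_ideal G) t) f -> monos t f.
Proof.
move=> t_gt0 [m [a [m_gt0 aP fm]]].
have {}aP i : (1 <= i <= m)%N -> monos (t * i) (a i).
  by move/aP/edge_ideal_exp_expP.
have {}fm : f ^+ m = - \sum_(1 <= i < m.+1) a i * f ^+ (m - i).
  by apply/eqP; rewrite -addr_eq0 fm.
have [/existsP[i /existsP[j ij]]|noadj] :=
  boolP [exists i, exists j, adj G i j].
  pose g : {mpoly k[n]} := 'X_[mload (nseq t (i, j))].
  have mg : monos t g.
    apply/monosX; rewrite -[X in packs _ X](size_nseq t (i, j)).
    by apply: packs_mload; rewrite all_nseq /= ij orbT.
  apply: (@monos_almost_integral _ (g ^+ m.-1)).
    by rewrite expf_neq0 // -msupp_eq0 msuppX.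
  move=> N; have [N'] := ubnP N; elim: N' N => // N' IHN N lt_N.
  (* Below [m] the factor [g ^+ m.-1] suffices by itself; from [m] on the integral equation reduces
     to smaller powers of [f]. *)
  have [lt_Nm|le_mN] := ltnP N m.
    rewrite mulrC; apply: monosMl; apply: (monos_le _ (monos_exp mg)).
    by rewrite leq_mul2l; lia.
  rewrite -(subnK le_mN) exprD fm mulrN mulrN; apply: monosN.
  rewrite mulrA mulr_sumr; apply: monos_sum => l.
  rewrite mem_index_iota => lP _.
  have -> : g ^+ m.-1 * f ^+ (N - m) * (a l * f ^+ (m - l)) =
      a l * (g ^+ m.-1 * f ^+ (N - l)).
    have -> : (N - l = (N - m) + (m - l))%N by lia.
    by rewrite exprD; ring.
  have -> : (t * (N - m + m) = t * l + t * (N - l))%N.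
    by rewrite -mulnDr; congr muln; lia.
  by apply: monosM; [apply: aP; lia | apply: IHN; lia].
(* Without edges the positive powers of the ideal are zero, and the equation becomes
   [f ^+ m = 0]. *)
have a0 i : (1 <= i <= m)%N -> a i = 0.
  move=> iP; apply/eqP; rewrite -msupp_eq0.
  case def_s: (msupp _) => [//|u s].
  have [|[|[x y] l] /packingP[zl el _]] := aP i iP u.
  - by rewrite def_s mem_head.
  - by move/esym/eqP: zl; rewrite muln_eq0; lia.
  case/negP: noadj; apply/existsP; exists x; apply/existsP; exists y.
  by case/andP: el.
suff -> : f = 0 by apply: monos0.
apply/eqP; have: f ^+ m == 0.
  rewrite fm big_nat_cond big1 ?oppr0 // => i; rewrite andbT ltnS => iP.
  by rewrite a0 // mul0r.
by rewrite expf_eq0 => /andP[].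
Qed.

Lemma edge_ideal_normal : normal_ideal (edge_ideal G (k := k)).
Proof.
move=> t t_gt0 f; split; last by move/(int_closure_monos t_gt0)/edge_ideal_expP.
(* An element of the ideal is a root of a monic equation of degree one. *)
move/edge_ideal_expP=> mf; exists 1%N, (fun=> - f); split=> //.
  move=> i /andP[i_gt0 i_le1]; apply/edge_ideal_exp_expP.
  have -> : i = 1%N by lia.
  by rewrite muln1; apply: monosN.
by rewrite big_nat1 expr1 subnn expr0 mulr1 subrr.
Qed.

End Closed.

(** The monomial with exponent [u] has its square in the [2 * t]-th power, so it is integral by an
    equation of degree two without linear term. *)
Lemma normal_halve : normal_ideal (edge_ideal G (k := k)) ->
  forall t (u : 'I_n -> nat), (0 < t)%N ->
    packs G (t * 2)%N (fun x => 2 * u x)%N -> packs G t u.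
Proof.
move=> normI t u t_gt0 pu; pose U : 'X_{1..n} := [multinom u i | i < n].
suff /monosX : monos t 'X_[U] by apply: packs_ext => x; rewrite mnmE.
apply/edge_ideal_expP/(normI t t_gt0).
exists 2%N, (fun i => if i == 2%N then - 'X_[U] ^+ 2 else 0); split=> //.
  move=> i _; apply/edge_ideal_exp_expP.
  case: eqP => [->|_]; last exact: monos0.
  apply: monosN; rewrite mpolyXn; apply/monosX.
  by apply: packs_ext pu => x; rewrite mulmnE mnmE mulnC.
by rewrite big_nat_recr //= big_nat1 /= mul0r add0r subnn expr0 mulr1 subrr.
Qed.

End MonomialIdeals.

Theorem theorem1p1 (k : fieldType) (n : nat) (G : wgraph 'I_n) :
  normal_ideal (@edge_ideal k n G) <->
  [/\ ~ has_induced G isF1, ~ has_induced G isF2, ~ has_induced G isF3,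
      ~ has_induced G isF4 & ~ has_induced G isF5].
Proof.
split=> [/normal_halve halve | [noF1 noF2 noF3 noF4 noF5]].
  split; [exact: halve_noF1 | exact: halve_noF2 | exact: halve_noF3
         | exact: halve_noF4 | exact: halve_noF5].
apply: edge_ideal_normal; exact: noF_packs_div.
Qed.
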